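(* Let $m > 1$ be an integer. Then (1) the elliptic curve $E_m \colon y^2 = x^3 - x + m^6$ over $\mathbf{Q}$ has rank at least $3$, and (2) the elliptic curve $E'_m \colon y^2 = x^3 + x - m^6$ over $\mathbf{Q}$ has rank at least $2$.
   Context: The rank of an elliptic curve $E/\mathbf{Q}$ is the integer $r\ge 0$ such that $E(\mathbf{Q}) \simeq \mathbf{Z}^r \oplus T$ with $T$ a finite abelian group (Mordell-Weil theorem). *)

(* Defs.v *)
From HB Require Import structures.
From mathcomp Require Import all_boot all_order all_algebra.
From mathcomp Require Import ring lra zify.
Set Implicit Arguments. Unset Strict Implicit. Unset Printing Implicit Defensive.
Import Order.TTheory GRing.Theory Num.Theory.
Local Open Scope ring_scope.

(* The curve y^2 = x^3 + a x + b.  The condition on the discriminant also      *)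
(* forces the characteristic of K to be different from 2.                      *)
Record ellcurve (K : fieldType) := EllCurve {
  ec_a : K;
  ec_b : K;
  ec_disc : - 16%:R * (4%:R * ec_a ^+ 3 + 27%:R * ec_b ^+ 2) != 0 }.

(* None is the point at infinity. *)
Definition on_curve (K : fieldType) (E : ellcurve K) (P : option (K * K)) :=
  if P is Some (x, y) then y ^+ 2 == x ^+ 3 + ec_a E * x + ec_b E else true.

Record point (K : fieldType) (E : ellcurve K) := Point {
  point_val :> option (K * K);
  point_on : on_curve E point_val }.

HB.instance Definition _ (K : fieldType) (E : ellcurve K) :=
  [isSub for @point_val K E].
HB.instance Definition _ (K : fieldType) (E : ellcurve K) :=
  [Choice of point E by <:].

Section ChordTangent.
Variables (K : fieldType) (E : ellcurve K).

Definition slope (x1 y1 x2 y2 : K) : K :=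
  if x1 == x2 then (3%:R * x1 ^+ 2 + ec_a E) / (2%:R * y1)
  else (y2 - y1) / (x2 - x1).

Definition neg_val (P : option (K * K)) : option (K * K) :=
  if P is Some (x, y) then Some (x, - y) else None.

Definition add_val (P Q : option (K * K)) : option (K * K) :=
  match P, Q with
  | None, _ => Q
  | _, None => P
  | Some (x1, y1), Some (x2, y2) =>
      if (x1 == x2) && (y1 == - y2) then None
      else
        let s := slope x1 y1 x2 y2 in
        let x3 := s ^+ 2 - x1 - x2 in
        Some (x3, s * (x1 - x3) - y1)
  end.

Let a := ec_a E.
Let b := ec_b E.

Lemma two_neq0 : 2%:R != 0 :> K.
Proof.
apply/eqP => h; case/eqP: (ec_disc E).
have -> : 16%:R = 2%:R * 8%:R :> K by ring.
by rewrite h !mul0r oppr0 mul0r.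
Qed.

Lemma tangent_neq0 x : on_curve E (Some (x, 0)) -> 3%:R * x ^+ 2 + a != 0.
Proof.
rewrite /= => /eqP h; apply/eqP => h2; case/eqP: (ec_disc E); rewrite -/a -/b in h *.
have ha : a = - (3%:R * x ^+ 2) by rewrite -[a](addKr (3%:R * x ^+ 2)) h2 addr0.
have hb : b = - (x ^+ 3 + a * x).
  by rewrite -[b](addKr (x ^+ 3 + a * x)) -h expr0n addr0.
by rewrite hb ha; ring.
Qed.

(* The two cases of [slope] satisfy the same polynomial relations. *)
Lemma slopeP x1 y1 x2 y2 :
    on_curve E (Some (x1, y1)) -> on_curve E (Some (x2, y2)) ->
    ~~ ((x1 == x2) && (y1 == - y2)) ->
  let s := slope x1 y1 x2 y2 in
  [/\ y2 = y1 + s * (x2 - x1),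
      a = 2%:R * s * y1 + s ^+ 2 * (x2 - x1) - x1 ^+ 2 - x1 * x2 - x2 ^+ 2,
      b = y1 ^+ 2 - x1 ^+ 3 - a * x1
    & (x1 != x2) || (y1 != 0)].
Proof.
rewrite /= -/a -/b => /eqP h1 /eqP h2 hn.
have hb : b = y1 ^+ 2 - x1 ^+ 3 - a * x1 by rewrite h1; ring.
rewrite /slope; case: eqP hn => [e|/eqP ne] /= hn.
  subst x2; have ey : y2 = y1.
    have : (y2 - y1) * (y1 + y2) = 0.
      by transitivity (y2 ^+ 2 - y1 ^+ 2); [ring | rewrite h1 h2 subrr].
    by move/eqP; rewrite mulf_eq0 subr_eq0 addr_eq0 (negPf hn) orbF => /eqP.
  subst y2; have y0 : y1 != 0.
    by apply: contra hn => /eqP ->; rewrite oppr0.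
  have t0 := two_neq0.
  by split=> //; [ring | rewrite -/a; field; rewrite t0 y0].
have d0 : x2 - x1 != 0 by rewrite subr_eq0 eq_sym.
split=> //; first by field.
set s := (_ / _).
have hs : s * (x2 - x1) = y2 - y1 by rewrite /s; field.
apply: (mulIf d0).
have e : a * (x2 - x1) = y2 ^+ 2 - y1 ^+ 2 - (x2 ^+ 3 - x1 ^+ 3).
  by rewrite h1 h2; ring.
rewrite e; have -> : y2 = y1 + s * (x2 - x1) by rewrite hs; ring.
ring.
Qed.

Lemma neg_on P : on_curve E P -> on_curve E (neg_val P).
Proof. by case: P => [[x y]|] //=; rewrite sqrrN. Qed.

Lemma add_on P Q : on_curve E P -> on_curve E Q -> on_curve E (add_val P Q).
Proof.
case: P => [[x1 y1]|] //; case: Q => [[x2 y2]|] // h1 h2 /=.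
case: ifPn => // /(slopeP h1 h2) /=; set s := slope _ _ _ _.
case=> ey ha hb _ /=; apply/eqP; rewrite -/a -/b hb ha; ring.
Qed.

Definition padd (P Q : point E) : point E :=
  Point (add_on (point_on P) (point_on Q)).
Definition popp (P : point E) : point E := Point (neg_on (point_on P)).
Definition pzero : point E := @Point K E None isT.

Lemma paddC : commutative padd.
Proof.
move=> P Q; apply/val_inj => /=.
case: P Q => [[[x1 y1]|] h1] [[[x2 y2]|] h2] //=.
have hc : (x2 == x1) && (y2 == - y1) = (x1 == x2) && (y1 == - y2).
  by rewrite [x2 == x1]eq_sym -eqr_oppLR [- y2 == _]eq_sym.
rewrite hc; case: ifPn => // hn1.
have [ey _ _ _] := slopeP h1 h2 hn1.
have es : slope x2 y2 x1 y1 = slope x1 y1 x2 y2.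
  rewrite /slope [x2 == x1]eq_sym; case: eqP => [e|/eqP ne].
    by move: ey; rewrite e subrr mulr0 addr0 => ->.
  by field; rewrite !subr_eq0 ne eq_sym ne.
rewrite es; move: (slope x1 y1 x2 y2) ey => s ey.
by congr (Some (_, _)); rewrite ?ey; ring.
Qed.

Lemma padd0 : left_id pzero padd.
Proof. by move=> P; apply/val_inj. Qed.

Lemma paddN : left_inverse pzero popp padd.
Proof. by case=> [[[x y]|] h]; apply/val_inj => //=; rewrite !eqxx. Qed.

End ChordTangent.

(* Associativity is proved through the ideal classes of the coordinate ring    *)
(* K[X, Y] / (Y^2 - X^3 - a X - b); the pair (p, q) stands for p + q Y.        *)
Definition cring (K : fieldType) (E : ellcurve K) : Type :=
  ({poly K} * {poly K})%type.

HB.instance Definition _ (K : fieldType) (E : ellcurve K) :=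
  GRing.Zmodule.copy (cring E) ({poly K} * {poly K})%type.

Section CoordRing.
Variables (K : fieldType) (E : ellcurve K).
Implicit Types (P Q : point E).

Definition cubic : {poly K} := 'X^3 + ec_a E *: 'X + (ec_b E)%:P.

Definition cr1 : cring E := (1, 0).
Definition crmul (u v : cring E) : cring E :=
  (u.1 * v.1 + cubic * (u.2 * v.2), u.1 * v.2 + u.2 * v.1).

Fact crmulA : associative crmul.
Proof. by case=> [p q] [p' q'] [p'' q'']; congr pair => /=; ring. Qed.
Fact crmulC : commutative crmul.
Proof. by case=> [p q] [p' q']; congr pair => /=; ring. Qed.
Fact crmul1 : left_id cr1 crmul.
Proof. by case=> [p q]; congr pair => /=; ring. Qed.
Fact crmulD : left_distributive crmul +%R.
Proof. by case=> [p q] [p' q'] [p'' q'']; congr pair => /=; ring. Qed.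
Fact cr1_neq0 : cr1 != 0.
Proof. by rewrite -pair_eqE /= negb_and oner_eq0. Qed.

HB.instance Definition _ := GRing.Zmodule_isComNzRing.Build (cring E)
  crmulA crmulC crmul1 crmulD cr1_neq0.

Definition nrm (u : cring E) : {poly K} := u.1 ^+ 2 - cubic * u.2 ^+ 2.

Lemma nrmM u v : nrm (u * v) = nrm u * nrm v.
Proof. by case: u v => [p q] [p' q']; rewrite /nrm /=; ring. Qed.

Lemma size_sqr (p : {poly K}) : size (p ^+ 2) = (2 * size p)%N.-1.
Proof.
have [->|p0] := eqVneq p 0; first by rewrite expr0n size_poly0.
have : (0 < size p)%N by rewrite size_poly_gt0.
by rewrite expr2 size_mul // mul2n addnn.
Qed.

Lemma size_cubic : size cubic = 4%N.
Proof.
rewrite /cubic -addrA size_polyDl size_polyXn //.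
rewrite (leq_ltn_trans (size_polyD _ _)) // gtn_max.
rewrite (leq_ltn_trans (size_scale_leq _ _)) ?size_polyX //.
by rewrite (leq_ltn_trans (size_polyC_leq1 _)).
Qed.

Lemma size_nrm u :
  size (nrm u) = if u.2 == 0 then (2 * size u.1)%N.-1
                 else maxn (2 * size u.1)%N.-1 (2 * size u.2 + 2)%N.
Proof.
rewrite /nrm; have [->|q0] := eqVneq u.2 0.
  by rewrite expr0n /= mulr0 subr0 size_sqr.
have s1 := size_sqr u.1.
have sq : (0 < size u.2)%N by rewrite size_poly_gt0.
have c0 : cubic != 0 by rewrite -size_poly_gt0 size_cubic.
have s2 : size (- (cubic * u.2 ^+ 2)) = (2 * size u.2 + 2)%N.
  by rewrite size_polyN size_mul ?expf_neq0 // size_cubic size_sqr; lia.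
rewrite -s1 -s2; have [h|h] := ltnP (size (u.1 ^+ 2)) (size (- (cubic * u.2 ^+ 2))).
  by rewrite addrC size_polyDl // (maxn_idPr (ltnW h)).
rewrite size_polyDl ?(maxn_idPl h) //.
by rewrite ltn_neqAle h andbT s1 s2; apply/eqP; lia.
Qed.

Lemma nrm_cancel u v : nrm u != 0 -> u * v = 0 -> v = 0.
Proof.
move=> u0 uv; have : ((u.1, - u.2) : cring E) * (u * v) = 0 by rewrite uv mulr0.
case: u v u0 {uv} => [p q] [p' q'] u0; rewrite mulrA => -[e1 e2].
have /eqP : nrm (p, q) * p' = 0 by rewrite -[RHS]e1 /nrm /=; ring.
have /eqP : nrm (p, q) * q' = 0 by rewrite -[RHS]e2 /nrm /=; ring.
by rewrite !mulf_eq0 (negPf u0) /= => /eqP -> /eqP ->.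
Qed.

Definition cK (k : K) : cring E := (k%:P, 0).
Definition cX : cring E := ('X, 0).
Definition cY : cring E := (0, 1).

Fact cK_zmod : zmod_morphism cK.
Proof. by move=> k l; congr pair; rewrite ?polyCB ?subr0. Qed.
Fact cK_monoid : monoid_morphism cK.
Proof. by split=> // k l; congr pair; rewrite /= ?polyCM; ring. Qed.
HB.instance Definition _ := GRing.isZmodMorphism.Build K (cring E) cK cK_zmod.
HB.instance Definition _ := GRing.isMonoidMorphism.Build K (cring E) cK cK_monoid.

Lemma cXE k : cX - cK k = ('X - k%:P, 0).
Proof. by congr pair; rewrite subr0. Qed.
Lemma cYE k : cY - cK k = (- k%:P, 1).
Proof. by congr pair; rewrite ?sub0r ?subr0. Qed.

Lemma cY2 : cY ^+ 2 = cX ^+ 3 + cK (ec_a E) * cX + cK (ec_b E).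
Proof.
rewrite exprS expr1 exprS expr2; congr pair => /=; rewrite /cubic -?mul_polyC; ring.
Qed.

Definition ideal (I : cring E -> Prop) :=
  (forall u v, I u -> I v -> I (u + v)) /\ (forall c u, I u -> I (c * u)).
Definition gen (u v : cring E) := fun z => exists c d, z = c * u + d * v.
Definition prd (I J : cring E -> Prop) := fun z =>
  forall L, ideal L -> (forall i j, I i -> J j -> L (i * j)) -> L z.
Definition eqv (I J : cring E -> Prop) := exists al be,
  [/\ nrm al != 0, nrm be != 0,
      forall i, I i -> exists2 j, J j & al * i = be * j
    & forall j, J j -> exists2 i, I i & al * i = be * j].
Definition idl P : cring E -> Prop :=
  if point_val P is Some (x, y) then gen (cX - cK x) (cY - cK y)
  else fun=> True.

Lemma gen_ideal u v : ideal (gen u v).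
Proof.
split=> [_ _ [c [d ->]] [c' [d' ->]]|e _ [c [d ->]]].
  by exists (c + c'), (d + d'); ring.
by exists (e * c), (e * d); ring.
Qed.

Lemma idl_ideal P : ideal (idl P).
Proof. by rewrite /idl; case: P => [[[x y]|] h] //=; apply: gen_ideal. Qed.

Lemma prd_ideal I J : ideal (prd I J).
Proof.
split=> [u v hu hv|c u hu] L hL hIJ.
  by apply: hL.1; [apply: hu | apply: hv].
by apply: hL.2; apply: hu.
Qed.

Lemma prd_mul (I J : cring E -> Prop) i j : I i -> J j -> prd I J (i * j).
Proof. by move=> hi hj L _; apply. Qed.

Lemma prdC I J z : prd I J z -> prd J I z.
Proof.
apply; first exact: prd_ideal.
by move=> i j hi hj; rewrite mulrC; apply: prd_mul.
Qed.

Lemma prdA I J L z : prd (prd I J) L z -> prd I (prd J L) z.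
Proof.
apply; first exact: prd_ideal.
move=> w l hw hl.
apply: (hw (fun w => prd I (prd J L) (w * l))).
  have [hD hM] := prd_ideal I (prd J L).
  by split=> [u v hu hv|c u hu]; rewrite ?mulrDl -?mulrA; [apply: hD|apply: hM].
by move=> i j hi hj; rewrite -mulrA; do !apply: prd_mul.
Qed.

Lemma nrm1 : nrm 1 != 0.
Proof. by rewrite /nrm /= expr0n expr1n mulr0 subr0 oner_eq0. Qed.

Lemma eqv_ext (I J : cring E -> Prop) :
  (forall z, I z -> J z) -> (forall z, J z -> I z) -> eqv I J.
Proof.
move=> h1 h2; exists 1, 1; split=> [||i hi|j hj]; try exact: nrm1.
  by exists i => //; apply: h1.
by exists j => //; apply: h2.
Qed.

Lemma eqv_sym I J : eqv I J -> eqv J I.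
Proof.
move=> [al [be [h1 h2 h3 h4]]]; exists be, al; split=> // [j|i].
  by move=> /h4 [i hi e]; exists i.
by move=> /h3 [j hj e]; exists j.
Qed.

Lemma eqv_trans J I L : eqv I J -> eqv J L -> eqv I L.
Proof.
move=> [al [be [h1 h2 h3 h4]]] [ga [de [k1 k2 k3 k4]]].
exists (ga * al), (be * de); split; rewrite ?nrmM ?mulf_neq0 //.
  move=> i /h3 [j /k3 [l hl e'] e]; exists l => //.
  by rewrite -mulrA e mulrCA e' mulrA.
move=> l /k4 [j /h4 [i hi e'] e]; exists i => //.
by rewrite -mulrA e' mulrCA e mulrA.
Qed.

Lemma eqv_prd I I' J : eqv I I' -> eqv (prd I J) (prd I' J).
Proof.
move=> [al [be [h1 h2 h3 h4]]]; exists al, be; split=> // z hz.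
  apply: (hz (fun z => exists2 w, prd I' J w & al * z = be * w)).
    have [hD hM] := prd_ideal I' J.
    split=> [u v [u' hu eu] [v' hv ev]|c u [u' hu eu]].
      by exists (u' + v'); [apply: hD | rewrite !mulrDr eu ev].
    by exists (c * u'); [apply: hM | rewrite mulrCA eu mulrCA].
  move=> i j /h3 [i' hi' e] hj; exists (i' * j); first exact: prd_mul.
  by rewrite !mulrA e.
apply: (hz (fun z => exists2 w, prd I J w & al * w = be * z)).
  have [hD hM] := prd_ideal I J.
  split=> [u v [u' hu eu] [v' hv ev]|c u [u' hu eu]].
    by exists (u' + v'); [apply: hD | rewrite !mulrDr eu ev].
  by exists (c * u'); [apply: hM | rewrite mulrCA eu mulrCA].
move=> i j /h4 [i' hi' e] hj; exists (i' * j); first exact: prd_mul.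
by rewrite !mulrA e.
Qed.

Lemma nrm_cX k : nrm (cX - cK k) = ('X - k%:P) ^+ 2.
Proof. by rewrite cXE /nrm /= expr0n mulr0 subr0. Qed.

Lemma nrm_cX_neq0 k : nrm (cX - cK k) != 0.
Proof. by rewrite nrm_cX expf_neq0 // polyXsubC_eq0. Qed.

Lemma gen_prd (u v u' v' : cring E) (L : cring E -> Prop) : ideal L ->
  L (u * u') -> L (u * v') -> L (v * u') -> L (v * v') ->
  forall z, prd (gen u v) (gen u' v') z -> L z.
Proof.
move=> hL h1 h2 h3 h4 z; apply=> // _ _ [c [d ->]] [c' [d' ->]].
have -> : (c * u + d * v) * (c' * u' + d' * v') =
  c * c' * (u * u') + c * d' * (u * v') + d * c' * (v * u') + d * d' * (v * v').
  by ring.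
by do !apply: hL.1; apply: hL.2.
Qed.

Lemma genl u v : gen u v u. Proof. by exists 1, 0; ring. Qed.
Lemma genr u v : gen u v v. Proof. by exists 0, 1; ring. Qed.

Lemma gen_sub (u v : cring E) (L : cring E -> Prop) : ideal L ->
  L u -> L v -> forall z, gen u v z -> L z.
Proof. by move=> hL hu hv _ [c [d ->]]; apply: hL.1; apply: hL.2. Qed.

(* P = (x, y) and -P = (x, -y): the product of the ideals is (X - x). *)
Lemma eqv_opp x y : on_curve E (Some (x, y)) ->
  eqv (prd (gen (cX - cK x) (cY - cK y)) (gen (cX - cK x) (cY - cK (- y))))
      (fun=> True).
Proof.
move=> hxy; apply: eqv_sym; set I := prd _ _.
have hI : ideal I by apply: prd_ideal.
set u := cX - cK x.
have hx : y ^+ 2 = x ^+ 3 + ec_a E * x + ec_b E by apply/eqP.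
pose g := cX ^+ 2 + cK x * cX + cK (x ^+ 2 + ec_a E).
have eg : (cY - cK y) * (cY - cK (- y)) = u * g.
  have eb : ec_b E = y ^+ 2 - x ^+ 3 - ec_a E * x by rewrite hx; ring.
  have -> : (cY - cK y) * (cY - cK (- y)) = cY ^+ 2 - cK (y ^+ 2) by ring.
  rewrite cY2 eb /u /g; ring.
exists u, 1; split=> [||z _|z hz]; [exact: nrm_cX_neq0 | exact: nrm1 | |].
  exists (u * z); last by rewrite mul1r.
  rewrite mulrC; apply: hI.2.
  have i1 : I (u * u) by apply: prd_mul; apply: genl.
  have i2 : I (u * (cY - cK (- y))) by apply: prd_mul; [apply: genl|apply: genr].
  have i3 : I (u * (cY - cK y)).
    by rewrite mulrC; apply: prd_mul; [apply: genr|apply: genl].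
  have i4 : I (u * g) by rewrite -eg; apply: prd_mul; apply: genr.
  have fin k : k != 0 -> I (u * cK k) -> I u.
    move=> k0 hk; have -> : u = cK k^-1 * (u * cK k).
      by rewrite mulrCA -rmorphM mulVf // rmorph1 mulr1.
    exact: hI.2.
  have [y0|y0] := eqVneq y 0.
    subst y; apply: fin (tangent_neq0 hxy) _.
    have -> : u * cK (3%:R * x ^+ 2 + ec_a E) =
              u * g + (- (cX + cK (2%:R * x))) * (u * u) by rewrite /u /g; ring.
    by apply: hI.1 => //; apply: hI.2.
  apply: (fin (2%:R * y)); first by rewrite mulf_neq0 ?(two_neq0 E).
  have -> : u * cK (2%:R * y) = u * (cY - cK (- y)) + (-1) * (u * (cY - cK y)).
    by ring.
  by apply: hI.1 => //; apply: hI.2.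
suff [w ->] : exists w, z = u * w by exists w; rewrite ?mul1r.
move: z hz; apply: gen_prd.
- split=> [_ _ [w ->] [w' ->]|c _ [w ->]]; first by exists (w + w'); ring.
  by exists (c * w); ring.
- by exists u.
- by exists (cY - cK (- y)).
- by exists (cY - cK y); rewrite mulrC.
- by exists g.
Qed.

(* The chord or tangent y = s (X - x1) + y1 has norm u1 u2 u3. *)
Lemma eqv_add P Q : eqv (prd (idl P) (idl Q)) (idl (padd P Q)).
Proof.
case: P Q => [[[x1 y1]|] h1] [[[x2 y2]|] h2]; last first.
- by apply: eqv_ext => // z _; rewrite -[z]mul1r; apply: prd_mul.
- apply: eqv_ext => z; first by apply=> [|i j _]; [exact: gen_ideal|apply: (gen_ideal _ _).2].
  by move=> hz; rewrite -[z]mul1r; apply: prd_mul.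
- apply: eqv_ext => z.
    by apply=> [|i j hi _]; [exact: gen_ideal|rewrite mulrC; apply: (gen_ideal _ _).2].
  by move=> hz; rewrite -[z]mulr1; apply: prd_mul.
rewrite /idl /=; case: ifPn => [/andP[/eqP ex /eqP ey]|hn].
  by subst x2 y1; rewrite -{2}[y2]opprK; apply: eqv_opp.
have [] := slopeP h1 h2 hn; set s := slope _ _ _ _ _; clearbody s.
move=> ey ea eb nz; set x3 := _ - x1 - x2; set y3 := _ - y1.
pose m : cring E := cK y1 + cK s * (cX - cK x1).
pose u1 : cring E := cX - cK x1; pose u2 : cring E := cX - cK x2; pose u3 : cring E := cX - cK x3.
pose l : cring E := cY - m; pose l' : cring E := cY + m.
have el : l * l' = u1 * u2 * u3.
  have -> : l * l' = cY ^+ 2 - m ^+ 2 by rewrite /l /l'; ring.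
  rewrite cY2 eb ea /u1 /u2 /u3 /m /x3; ring.
have w1 : cY - cK y1 = l + cK s * u1 by rewrite /l /m /u1; ring.
have w2 : cY - cK y2 = l + cK s * u2 by rewrite ey /l /m /u2; ring.
have w3 : cY - cK y3 = l' - cK s * u3 by rewrite /l' /m /u3 /y3; ring.
rewrite -/u1 -/u2 -/u3 w1 w2 w3; set I := prd _ _; set J := gen _ _.
have hI : ideal I by apply: prd_ideal.
have hJ : ideal J by apply: gen_ideal.
have gl (u : cring E) : gen u (l + cK s * u) l by exists (- cK s), 1; ring.
have gl' : J l' by exists (cK s), 1; ring.
have gu3 : J u3 by apply: genl.
have ll' : I (u1 * u2) by apply: prd_mul; apply: genl.
have l1 : I (u1 * l) by apply: prd_mul; [apply: genl|].
have l2 : I (u2 * l) by rewrite mulrC; apply: prd_mul; [|apply: genl].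
have l3 : I (l * l) by apply: prd_mul.
have il : I l.
  have [e|ne] := eqVneq x1 x2; last first.
    have e : cK (x2 - x1)^-1 * cK (x2 - x1) = 1.
      by rewrite -rmorphM mulVf ?rmorph1 // subr_eq0 eq_sym.
    rewrite -[l]mul1r -e -mulrA; apply: hI.2.
    have -> : cK (x2 - x1) * l = u1 * l + (-1) * (u2 * l) by rewrite /u1 /u2; ring.
    by apply: hI.1 => //; apply: hI.2.
  move: nz; rewrite e eqxx /= => y0.
  have e2 : cK (2%:R * y1)^-1 * cK (2%:R * y1) = 1.
    by rewrite -rmorphM mulVf ?rmorph1 // mulf_neq0 // (two_neq0 E).
  rewrite -[l]mul1r -e2 -mulrA; apply: hI.2.
  have -> : cK (2%:R * y1) * l =
      u3 * (u1 * u2) + (-1) * (l * l) + (- (2%:R * cK s)) * (u1 * l).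
    by rewrite mulrC [u3 * _]mulrC -el /l /l' /m /u1; ring.
  by apply: hI.1; [apply: hI.1|]; rewrite -?el; apply: hI.2.
have jg (u : cring E) (L : cring E -> Prop) : ideal L -> L u -> L l ->
    L (l + cK s * u).
  by move=> hL hu hl; apply: hL.1 => //; apply: hL.2.
exists u3, l; split.
- exact: nrm_cX_neq0.
- apply/eqP => /(congr1 (fun z => z * nrm l')); rewrite mul0r -nrmM el !nrmM.
  by move/eqP; rewrite !mulf_eq0 !(negPf (nrm_cX_neq0 _)).
- pose L (z : cring E) := exists2 j, J j & u3 * z = l * j.
  have hL : ideal L.
    split=> [u' v' [u hu eu] [v hv ev]|c u' [u hu eu]].
      by exists (u + v); [apply: hJ.1 | rewrite !mulrDr eu ev].
    by exists (c * u); [apply: hJ.2 | rewrite mulrCA eu mulrCA].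
  have Ll (z : cring E) : L (z * l).
    by exists (z * u3); [apply: hJ.2 | ring].
  have Lu : L (u1 * u2) by exists l' => //; rewrite el; ring.
  apply: gen_prd => //.
  + have -> : u1 * (l + cK s * u2) = u1 * l + cK s * (u1 * u2) by ring.
    by apply: hL.1 => //; apply: hL.2.
  + have -> : (l + cK s * u1) * u2 = u2 * l + cK s * (u1 * u2) by ring.
    by apply: hL.1 => //; apply: hL.2.
  + have -> : (l + cK s * u1) * (l + cK s * u2) =
      (l + cK s * u1 + cK s * u2) * l + cK s ^+ 2 * (u1 * u2) by ring.
    by apply: hL.1 => //; apply: hL.2.
- apply: gen_sub.
  + split=> [u' v' [u hu eu] [v hv ev]|c u' [u hu eu]].
      by exists (u + v); [apply: hI.1 | rewrite !mulrDr eu ev].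
    by exists (c * u); [apply: hI.2 | rewrite mulrCA eu mulrCA].
  + by exists l => //; ring.
  + exists (u1 * u2 + (- cK s) * l); first by apply: hI.1 => //; apply: hI.2.
    have -> : l * (l' - cK s * u3) = l * l' - cK s * u3 * l by ring.
    by rewrite el; ring.
Qed.

Lemma idl_ev x y z : on_curve E (Some (x, y)) ->
  gen (cX - cK x) (cY - cK y) z -> z.1.[x] + z.2.[x] * y = 0.
Proof.
move=> /eqP h [[c1 c2] [[d1 d2] ->]]; rewrite cXE cYE /= /cubic !hornerE /=.
have eb : ec_b E = y ^+ 2 - x ^+ 3 - ec_a E * x by rewrite h; ring.
by rewrite eb; ring.
Qed.

Lemma size_nrm_neq2 z : size (nrm z) != 2.
Proof.
rewrite size_nrm; have [_|] := eqVneq z.2 0; first by apply/eqP; lia.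
by rewrite -size_poly_gt0 => h; apply/eqP; lia.
Qed.

Lemma size_nrm_idl x y z : on_curve E (Some (x, y)) ->
  gen (cX - cK x) (cY - cK y) z -> nrm z != 0 -> (2 < size (nrm z))%N.
Proof.
move=> h hz; rewrite -size_poly_gt0 => z0.
have n2 := size_nrm_neq2 z; rewrite ltn_neqAle eq_sym n2 /= ltn_neqAle z0 andbT.
apply/eqP => /esym; rewrite size_nrm; have [q0|] := eqVneq z.2 0; last by rewrite -size_poly_gt0; lia.
move=> s1; have /eqP/size_poly1P[c c0 ec] : size z.1 = 1 by lia.
have := idl_ev h hz; rewrite q0 ec !hornerE => /eqP.
by rewrite (negPf c0).
Qed.

Lemma size_mulS (p q : {poly K}) : p != 0 -> q != 0 ->
  (size (p * q)).+1 = (size p + size q)%N.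
Proof.
by move=> p0 q0; rewrite size_mul // prednK // addn_gt0 size_poly_gt0 p0.
Qed.

Lemma size_nrm_eq al be u g : nrm al != 0 -> nrm be != 0 -> nrm u != 0 ->
  al * u = be * g -> nrm g != 0 /\
  (size (nrm al) + size (nrm u) = size (nrm be) + size (nrm g))%N.
Proof.
move=> a0 b0 u0 /(congr1 nrm); rewrite !nrmM => e.
have g0 : nrm g != 0.
  by apply/eqP => g0; move/eqP: e; rewrite g0 mulr0 mulf_eq0 (negPf a0) (negPf u0).
by split=> //; rewrite -!size_mulS // e.
Qed.

Lemma size_nrm_cX k : size (nrm (cX - cK k)) = 3%N.
Proof. by rewrite nrm_cX size_sqr size_XsubC. Qed.

Lemma size_nrm_cY k : size (nrm (cY - cK k)) = 4%N.
Proof.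
rewrite size_nrm cYE /= oner_eq0 size_polyN size_poly1.
by have := size_polyC_leq1 k; case: (size _) => [|[]].
Qed.

Lemma nrm_cY_neq0 k : nrm (cY - cK k) != 0.
Proof. by rewrite -size_poly_gt0 size_nrm_cY. Qed.

Lemma idl_inj0 x y : on_curve E (Some (x, y)) ->
  eqv (fun=> True) (gen (cX - cK x) (cY - cK y)) -> False.
Proof.
move=> hxy [al [be [a0 b0 h1 h2]]].
have [g hg eg] := h1 1 I.
have [g' _ eg'] := h2 _ (genl _ _).
have [h' _ eh'] := h2 _ (genr (cX - cK x) (cY - cK y)).
have [g0 sg] := size_nrm_eq a0 b0 nrm1 eg.
have [g1 sg'] := size_nrm_eq b0 a0 (nrm_cX_neq0 _) (esym eg').
have [_ sh'] := size_nrm_eq b0 a0 (nrm_cY_neq0 _) (esym eh').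
have g3 := size_nrm_idl hxy hg g0.
have := size_nrm_neq2 h'; have := size_nrm_neq2 g'; move: sg' sh' sg.
have -> : size (nrm 1) = 1 by rewrite size_nrm /= eqxx size_poly1.
by move: g1; rewrite -size_poly_gt0 size_nrm_cX size_nrm_cY; lia.
Qed.

Lemma idl_inj P Q : eqv (idl P) (idl Q) -> P = Q.
Proof.
case: P Q => [[[x y]|] h] [[[x' y']|] h'] e; apply/val_inj => //=; last first.
- by case: (idl_inj0 h' e).
- by case: (idl_inj0 h (eqv_sym e)).
move: e => [al [be [a0 b0]]]; rewrite /idl /= => h1 h2.
have [g hg eg] := h1 _ (genl _ _).
have [k hk ek] := h1 _ (genr (cX - cK x) (cY - cK y)).
have [g' hg' eg'] := h2 _ (genl _ _).
have [g0 sg] := size_nrm_eq a0 b0 (nrm_cX_neq0 _) eg.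
have [k0 sk] := size_nrm_eq a0 b0 (nrm_cY_neq0 _) ek.
have [g'0 sg'] := size_nrm_eq b0 a0 (nrm_cX_neq0 _) (esym eg').
have g3 := size_nrm_idl h' hg g0; have g'3 := size_nrm_idl h hg' g'0.
rewrite !size_nrm_cX size_nrm_cY in sg sk sg'.
have {}sk : size (nrm k) = 4 by lia.
have {}sg : size (nrm g) = 3 by lia.
have eg2 : g.2 = 0.
  apply/eqP/negPn/negP => q0; move: sg; rewrite size_nrm (negPf q0).
  by move: q0; rewrite -size_poly_gt0; lia.
have /eqP/size_poly1P[c c0 ec] : size k.2 = 1.
  move: sk; rewrite size_nrm; have [_|] := eqVneq k.2 0; first by lia.
  by rewrite -size_poly_gt0; lia.
have : (cX - cK x) * k - (cY - cK y) * g = 0.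
  apply: (nrm_cancel a0); rewrite mulrBr !mulrA eg ek; ring.
move/eqP; rewrite subr_eq0 cXE cYE => /eqP[].
rewrite eg2 ec !(mul0r, mulr0, addr0, mul1r, add0r) => e1 e2.
have ek1 : k.1 = - (y * c)%:P.
  apply: (mulfI (negbT (polyXsubC_eq0 x))).
  by rewrite e1 -e2 polyCM; ring.
have := idl_ev h' hg; rewrite eg2 -e2 !hornerE => /eqP.
rewrite mulf_eq0 (negPf c0) orbF subr_eq0 => /eqP ->.
have := idl_ev h' hk; rewrite ek1 ec !hornerE => ez.
have /eqP : c * (y' - y) = 0 by rewrite -ez; ring.
by rewrite mulf_eq0 (negPf c0) subr_eq0 => /eqP ->.
Qed.

Lemma paddA : associative (@padd K E).
Proof.
move=> P Q R; apply: idl_inj.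
have add3 P1 P2 P3 : eqv (prd (prd (idl P1) (idl P2)) (idl P3))
                         (idl (padd (padd P1 P2) P3)).
  by apply: eqv_trans (eqv_add _ _); apply/eqv_prd/eqv_add.
rewrite [padd P _]paddC [padd Q R]paddC.
apply: (eqv_trans (eqv_sym (add3 _ _ _))); apply: eqv_trans (add3 _ _ _).
have sw I J L z : prd (prd I J) L z -> prd (prd L J) I z.
  move=> /prdA /prdC hz; move: z hz => z hz L' hL' h; apply: (hz L' hL') => u v hu hv.
  by apply: h => //; apply: prdC.
by apply: eqv_ext => z; apply: sw.
Qed.

End CoordRing.

HB.instance Definition _ (K : fieldType) (E : ellcurve K) :=
  GRing.isZmodule.Build (point E)
    (@paddA K E) (@paddC K E) (@padd0 K E) (@paddN K E).

(* A relation rather than a function: it determines r, but the existence of r  *)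
(* for E(Q) is the Mordell-Weil theorem.                                       *)
Definition has_rank (A : zmodType) (r : nat) : Prop :=
  exists (T : finZmodType) (f : {additive A -> ('rV[int]_r * T)%type}),
    bijective f.

Lemma disc_Em (m : int) :
  - 16%:R * (4%:R * (-1) ^+ 3 + 27%:R * ((m ^+ 6)%:~R) ^+ 2) != 0 :> rat.
Proof.
have -> : - 16%:R * (4%:R * (-1) ^+ 3 + 27%:R * ((m ^+ 6)%:~R) ^+ 2) =
  (64%:R - 432%:R * (m ^+ 6) ^+ 2)%:~R :> rat by ring.
by rewrite intr_eq0; apply/eqP; move: ((m ^+ 6) ^+ 2) => k; lia.
Qed.

Lemma disc_Em' (m : int) :
  - 16%:R * (4%:R * 1 ^+ 3 + 27%:R * (- (m ^+ 6)%:~R) ^+ 2) != 0 :> rat.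
Proof.
have -> : - 16%:R * (4%:R * 1 ^+ 3 + 27%:R * (- (m ^+ 6)%:~R) ^+ 2) =
  (- 64%:R - 432%:R * (m ^+ 6) ^+ 2)%:~R :> rat by ring.
by rewrite intr_eq0; apply/eqP; move: ((m ^+ 6) ^+ 2) => k; lia.
Qed.

Definition Em (m : int) : ellcurve rat :=
  @EllCurve rat (-1) ((m ^+ 6)%:~R) (disc_Em m).
Definition Em' (m : int) : ellcurve rat :=
  @EllCurve rat 1 (- (m ^+ 6)%:~R) (disc_Em' m).

(* Main.v *)
Require Import Defs.
From mathcomp Require Import all_boot all_order all_algebra.
From mathcomp Require Import ring lra zify.
Import Order.TTheory GRing.Theory Num.Theory.
Local Open Scope ring_scope.
Set Implicit Arguments. Unset Strict Implicit. Unset Printing Implicit Defensive.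

(* Neither curve has a rational point of order 2, so the rank is the dimension
   of E(Q)/2E(Q), and it suffices that no nonempty sum of the points
   P1 = (0, m^3), P2 = (1, m^3), P3 = (-m^2, -m) of E_m, respectively
   Q1 = (m^6, m^9), Q2 = (m^2, m) of E'_m, is of the form 2 W.  The slope of the
   tangent at such a W would be a root of a quartic polynomial with coefficients
   in Z[m], which turns each of the ten sums into a quartic equation in two
   integers.  These equations are solved by congruences, by factorisations, and
   by Fermat descent for r^2 + s^2, r^2 - s^2 both squares, for x^2 - 12 k^4 = 1,
   for x^2 - 108 k^4 = 1, and for k^2 = h^4 - 2 a^2 h^2 + 4 a^4. *)

(** The quartics must be excluded for each single [m > 1]: specialising from the generic curve would
    leave finitely many exceptions, and at [m = 1] the quartics of [P1 + P2], [P1 + P2 + P3] and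
    [Q1 + Q2] do have integer roots. The points come from cancelling terms of the equations:
    [x ^+ 3 - x = 0] at [P1] and [P2], [x ^+ 3 + m ^+ 6 = 0] at [P3], [x - m ^+ 6 = 0] at [Q1],
    [x ^+ 3 - m ^+ 6 = 0] at [Q2]. The slope at [W] is a better unknown than the abscissa of [W],
    because its quartic does not contain the coefficient [b] of the curve, here [m ^+ 6] up to sign.
    It is also monic after scaling by the denominator [d] of the point, so a rational root is an
    integer and no denominator of [W] enters. Descent is needed for three sums only: [P1 + P2 + P3],
    and the two with non-integral coordinates, [P1 + P3] and [Q1 + Q2], where [d = m]. *)

(** * Powers with coprime factors, and residues modulo 2, 3 and 8 *)

(** Taking [\pi(a)]-parts is multiplicative, fixes [a] and sends [b] to 1, so the root is the
    [\pi(a)]-part of [c]. If [c = 0], one factor is 0 and coprimality makes the other 1. *)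
Lemma coprime_mul_expn (k a b c : nat) :
  coprime a b -> (a * b = c ^ k)%N -> exists d, a = (d ^ k)%N.
Proof.
case: k => [|k] hab e.
  by exists 1%N; move/eqP: e; rewrite expn0 muln_eq1 => /andP[/eqP].
have [c0|c0] := posnP c.
  move: e hab; rewrite c0 exp0n // => /eqP; rewrite muln_eq0 => /orP[]/eqP->.
    by exists 0%N; rewrite exp0n.
  by rewrite /coprime gcdn0 => /eqP ->; exists 1%N; rewrite exp1n.
have : (0 < a * b)%N by rewrite e expn_gt0 c0.
rewrite muln_gt0 => /andP[a0 b0].
exists (c`_\pi(a))%N; rewrite -partnX -e partnM // part_pnat_id ?pnat_pi //.
by rewrite part_p'nat ?muln1 // -coprime_pi'.
Qed.

Lemma coprimez_mul_exp (k : nat) (a b c : int) :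
  coprimez a b -> a * b = c ^+ k -> exists d : int, a = d ^+ k \/ a = - d ^+ k.
Proof.
move=> hab e.
have [|d ed] := @coprime_mul_expn k `|a|%N `|b|%N `|c|%N hab.
  by rewrite -abszM e abszX.
exists d%:Z; have d0 : 0 <= d%:Z ^+ k by rewrite exprn_ge0.
have {}ed : `|a|%N = `|d%:Z ^+ k|%N by rewrite abszX.
by case: (ger0P a) => h; [left|right]; lia.
Qed.

Lemma coprimez_mul_sqr_ge0 (a b c : int) :
  0 <= a -> coprimez a b -> a * b = c ^+ 2 -> exists d : int, a = d ^+ 2.
Proof.
move=> a0 hab /(coprimez_mul_exp hab)[d [->|ea]]; first by exists d.
exists 0; have := sqr_ge0 d; lia.
Qed.

Lemma coprimez_mul_exp_ge0 (k : nat) (a b c : int) :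
  0 <= a -> 0 <= b -> coprimez a b -> a * b = c ^+ k ->
  exists d e : int, a = d ^+ k /\ b = e ^+ k.
Proof.
have pow x y : 0 <= x -> coprimez x y -> x * y = c ^+ k -> exists d, x = d ^+ k.
  move=> x0 hxy exy; have [|d ed] := @coprime_mul_expn k `|x|%N `|y|%N `|c|%N hxy.
    by rewrite -abszM exy abszX.
  exists d%:Z; have d0 : 0 <= d%:Z ^+ k by rewrite exprn_ge0.
  have {}ed : `|x|%N = `|d%:Z ^+ k|%N by rewrite abszX.
  by clear -ed d0 x0; lia.
move=> a0 b0 hab e; have [d ed] := pow a b a0 hab e.
have [|e' ee] := pow b a b0 _ (etrans (mulrC _ _) e); first by rewrite coprimez_sym.
by exists d, e'.
Qed.

(** This reduces coprimality claims to an identity for [ring]: it is enough to combine [x] and [y]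
    into a number already known to be prime to [x]. *)
Lemma coprimez_lincomb (x y c al be : int) :
  coprimez x c -> al * x + be * y = c -> coprimez x y.
Proof.
move=> /coprimezP[[u v] /= h] e; apply/coprimezP; exists (u + v * al, v * be) => /=.
by rewrite -h -e; ring.
Qed.

Lemma parity (x : int) : exists y : int, x = 2 * y \/ x = 2 * y + 1.
Proof. by exists (x %/ 2)%Z; lia. Qed.

(** This makes the 2-adic contradictions below linear enough for [lia]: odd squares are replaced by
    [8 * j + 1], and odd fourth powers by the square of that. *)
Lemma odd_sqr (y : int) : exists j : int, (2 * y + 1) ^+ 2 = 8 * j + 1.
Proof.
have [k [->|->]] := parity y.
  by exists (k * (2 * k + 1)); ring.
by exists ((2 * k + 1) * (k + 1)); ring.
Qed.


Lemma ltn_absz_sqr (x y : int) : x ^+ 2 < y ^+ 2 -> (`|x| < `|y|)%N.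
Proof. by move=> h; rewrite -ltz_nat !abszE -ltr_sqr ?nnegrE // !real_normK ?num_real. Qed.

Lemma coprimez_sum_diff (x y : int) :
  coprimez x y -> coprimez (x + y) 2 -> coprimez (x + y) (x - y).
Proof.
move=> /coprimezP[[u v] /= e] h; apply: (coprimez_lincomb h (al := u + v) (be := u - v)).
by transitivity (2 * (u * x + v * y)); [ring | rewrite e mulr1].
Qed.

Lemma coprimez_2 (y : int) : coprimez (2 * y + 1) 2.
Proof. by apply/coprimezP; exists (1, - y) => /=; ring. Qed.

Lemma exp4_sqr (x y : int) : x ^+ 4 = y ^+ 4 -> x ^+ 2 = y ^+ 2.
Proof.
move=> e; apply/eqP.
rewrite -(@eqrXn2 _ 2 (x ^+ 2) (y ^+ 2)) ?sqr_ge0 //.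
by rewrite -!exprM e.
Qed.

Lemma sqr_mod3 (x : int) : exists j : int, x ^+ 2 = 3 * j \/ x ^+ 2 = 3 * j + 1.
Proof.
have [y [->|[->|->]]] : exists y, x = 3 * y \/ x = 3 * y + 1 \/ x = 3 * y + 2.
- by exists (x %/ 3)%Z; lia.
- by exists (3 * y ^+ 2); left; ring.
- by exists (3 * y ^+ 2 + 2 * y); right; ring.
- by exists (3 * y ^+ 2 + 4 * y + 1); right; ring.
Qed.

Lemma coprimez_3 (x : int) : coprimez 3 x \/ exists y, x = 3 * y.
Proof.
have [y [->|[->|->]]] : exists y, x = 3 * y \/ x = 3 * y + 1 \/ x = 3 * y + 2.
- by exists (x %/ 3)%Z; lia.
- by right; exists y.
- by left; apply/coprimezP; exists (- y, 1) => /=; ring.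
- by left; apply/coprimezP; exists (y + 1, -1) => /=; ring.
Qed.

Lemma ltn_absz_exp4 (x y : int) : x ^+ 4 < y ^+ 4 -> (`|x| < `|y|)%N.
Proof.
move=> h; apply: ltn_absz_sqr.
by rewrite -(@ltr_pXn2r _ 2) ?nnegrE ?sqr_ge0 // -!exprM.
Qed.

Lemma dvdz_mul_ex (c x y z : int) :
  coprimez c y -> x * y = c * z -> exists f, x = c * f.
Proof.
move=> h e; have : (c %| x)%Z by rewrite -(Gauss_dvdzl x h) e dvdz_mulr.
by case/dvdzP=> f ->; exists f; rewrite mulrC.
Qed.

(** * Fermat descents *)

(* Descent: with s = 2 p q one gets r^2 = p^4 + 4 q^4, hence q = u v with
   v^4 - u^4 = p^2, so that v^2 + u^2 and v^2 - u^2 are again squares. *)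
Lemma one_not_congruent (r s a b : int) :
  coprimez r s -> r ^+ 2 + s ^+ 2 = a ^+ 2 -> r ^+ 2 - s ^+ 2 = b ^+ 2 -> s = 0.
Proof.
have [n] := ubnP `|s|%N; elim: n r s a b => // n IH r s a b hn hrs ea eb.
have [r' hr] : exists r', r = 2 * r' + 1.
  have [r' [er|er]] := parity r; last by exists r'.
  have [s' [es|es]] := parity s.
    by move: hrs => /coprimezP[[u v] /=]; rewrite er es; lia.
  have [j ej] := odd_sqr s'; rewrite -es in ej; rewrite er in ea eb.
  have [b' [ebb|ebb]] := parity b; first by rewrite ebb in eb; lia.
  by have [k ek] := odd_sqr b'; rewrite -ebb in ek; lia.
have [j ej] := odd_sqr r'; rewrite -hr in ej.
have [t hs] : exists t, s = 2 * t.
  have [s' [es|es]] := parity s; first by exists s'.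
  have [k ek] := odd_sqr s'; rewrite -es in ek.
  have [b' [ebb|ebb]] := parity a; first by rewrite ebb in ea; lia.
  by have [l el] := odd_sqr b'; rewrite -ebb in el; lia.
(* The numbers [(a - b) / 2] and [(a + b) / 2] are the legs of a Pythagorean triangle with
   hypotenuse [r] and area [t ^+ 2]; the even leg is then renamed [2 * x]. *)
have [x [y [exy ex ey]]] : exists x y, [/\ x * y = t ^+ 2, coprimez x y &
    r ^+ 2 = 4 * x ^+ 2 + y ^+ 2].
  have [x [y [hx hy]]] : exists x y, a = x + y /\ b = y - x.
    have [a' [e1|e1]] := parity a; have [b' [e2|e2]] := parity b;
      rewrite e1 e2 hs in ea eb *; try lia.
    by exists (a' - b'), (a' + b' + 1); lia.
  have e1 : r ^+ 2 = x ^+ 2 + y ^+ 2.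
    by rewrite hx hy in ea eb; lia.
  have e2 : s ^+ 2 = 2 * x * y by rewrite hx hy in ea eb; lia.
  have hxy : coprimez x y.
    have /coprimezP[[u v] /= h] : coprimez (r ^+ 2) (s ^+ 2).
      by apply/coprimezXl/coprimezXr.
    apply/coprimezP; exists (u * x + 2 * v * y, u * y) => /=.
    by apply: (eq_trans _ h); rewrite e1 e2; ring.
  rewrite hs in e2.
  have [x' [e3|e3]] := parity x.
    exists x', y; split; last by rewrite e1 e3; ring.
      by rewrite e3 in e2; clear -e2; lia.
    case/coprimezP: hxy => -[u v] /= h; apply/coprimezP; exists (2 * u, v) => /=.
    by apply: (eq_trans _ h); rewrite e3; ring.
  have [y' [e4|e4]] := parity y; last first.
    have [k ek] := odd_sqr x'; have [l el] := odd_sqr y'.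
    by rewrite -e3 in ek; rewrite -e4 in el; clear -e1 ej ek el; lia.
  exists y', x; split; last by rewrite e1 e4; ring.
    by rewrite e4 in e2; clear -e2; lia.
  case/coprimezP: hxy => -[u v] /= h; apply/coprimezP; exists (2 * v, u) => /=.
  by apply: (eq_trans _ h); rewrite e4; ring.
have [q hq] := coprimez_mul_exp ex exy.
have [p hp] : exists p, y = p ^+ 2 \/ y = - p ^+ 2.
  by apply: (@coprimez_mul_exp 2 y x t); rewrite ?[coprimez y x]coprimez_sym // mulrC.
have hxy : x ^+ 2 = q ^+ 4 /\ y ^+ 2 = p ^+ 4 by split; [case: hq|case: hp] => ->; ring.
case: hxy => x2 y2.
have t4 : t ^+ 4 = (p * q) ^+ 4.
  by transitivity ((x * y) ^+ 2); [rewrite exy; ring | rewrite exprMn x2 y2; ring].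
have [->|s0] := eqVneq s 0; first by [].
have t0 : t ^+ 4 != 0.
  by rewrite expf_neq0 //; apply: contra s0 => /eqP t0; rewrite hs t0 mulr0.
move: (t0); rewrite t4 expf_eq0 /= mulf_eq0 negb_or => /andP[p0 q0].
have hpq : coprimez (p ^+ 2) (q ^+ 4).
  have : coprimez (y ^+ 2) (x ^+ 2) by rewrite coprimez_pexpl // coprimez_pexpr // coprimez_sym.
  by rewrite x2 y2 !coprimez_pexpl // !coprimez_pexpr.
rewrite x2 y2 in ey.
have [p' hp'] : exists p', p = 2 * p' + 1.
  have [p' [e|e]] := parity p; last by exists p'.
  by rewrite e in ey; clear -ey ej; lia.
have [k ek] := odd_sqr p'; rewrite -hp' in ek.
pose R := `|r|.
have eR : R ^+ 2 = 4 * q ^+ 4 + (p ^+ 2) ^+ 2.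
  by rewrite /R real_normK ?num_real // ey; ring.
have [f ef] : exists f, R = 2 * f + p ^+ 2.
  have [f [e|e]] : exists f, R = 2 * f \/ R = 2 * f + 1 := parity R.
    by rewrite e ek in eR; clear -eR; lia.
  by exists (f - 4 * k); rewrite ek e; ring.
have efg : f * (f + p ^+ 2) = q ^+ 4 by rewrite ef in eR; clear -eR; lia.
have R0 : 0 <= R by apply: normr_ge0.
have p20 : 0 < p ^+ 2 by rewrite exprn_even_gt0.
have q40 : 0 < q ^+ 4 by rewrite exprn_even_gt0.
have f0 : 0 <= f.
  have : 0 < f * (f + p ^+ 2) by rewrite efg.
  by clear -p20 R0 ef; nia.
have cfp : coprimez f (p ^+ 2).
  rewrite coprimez_sym; apply: (coprimez_lincomb hpq (al := f) (be := f)).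
  by rewrite -efg; ring.
have cfg : coprimez f (f + p ^+ 2).
  by apply: (coprimez_lincomb cfp (al := -1) (be := 1)); ring.
have g0 : 0 <= f + p ^+ 2 by rewrite addr_ge0 // ltW.
have [u [v [eu ev]]] := coprimez_mul_exp_ge0 f0 g0 cfg efg.
have euv : (v ^+ 2 + u ^+ 2) * (v ^+ 2 - u ^+ 2) = p ^+ 2.
  by transitivity (v ^+ 4 - u ^+ 4); [ring | rewrite -ev -eu; ring].
have cvu : coprimez v u.
  by move: cfg; rewrite ev eu coprimez_pexpl // coprimez_pexpr // coprimez_sym.
have c1 : coprimez (v ^+ 2 + u ^+ 2) (v ^+ 2 - u ^+ 2).
  apply: coprimez_sum_diff; first by rewrite coprimez_pexpl // coprimez_pexpr.
  have [w [e|e]] := parity (v ^+ 2 + u ^+ 2); last by rewrite e coprimez_2.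
  by rewrite e ek in euv; clear -euv; lia.
have [al eal] : exists al, v ^+ 2 + u ^+ 2 = al ^+ 2.
  by apply: (coprimez_mul_sqr_ge0 _ c1 euv); rewrite addr_ge0 ?sqr_ge0.
have [be ebe] : exists be, v ^+ 2 - u ^+ 2 = be ^+ 2.
  apply: (@coprimez_mul_sqr_ge0 _ (v ^+ 2 + u ^+ 2) p); rewrite 1?coprimez_sym 1?mulrC //.
  have : 0 <= v ^+ 2 + u ^+ 2 by rewrite addr_ge0 ?sqr_ge0.
  by rewrite -euv in p20; clear -p20; nia.
have u0 : u = 0.
  apply: (IH v u al be) => //.
  apply: leq_trans (hn : (`|s| <= n)%N); apply: ltn_absz_sqr.
  have q4 : q ^+ 4 = (u * v) ^+ 4.
    by rewrite -efg ev eu; ring.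
  have q2 := exp4_sqr q4.
  have t2 := exp4_sqr t4.
  have -> : s ^+ 2 = u ^+ 2 * (4 * p ^+ 2 * v ^+ 2).
    by rewrite hs exprMn t2 exprMn q2; ring.
  have q20 : 0 < q ^+ 2 by rewrite exprn_even_gt0.
  rewrite q2 exprMn in q20.
  have u20 : 0 < u ^+ 2.
    by rewrite lt0r sqr_ge0 andbT; apply: contraTneq q20 => ->; rewrite mul0r ltxx.
  rewrite pmulr_rgt0 // in q20.
  have : 0 < p ^+ 2 * v ^+ 2 by rewrite mulr_gt0.
  by rewrite ltr_pMr //; clear; lia.
by move: q40; rewrite -efg eu u0 expr0n mul0r ltxx.
Qed.

(** The half sum [x] and half difference [y] of [a ^+ 2] and [b ^+ 2] are coprime with product
    [(c / 2) ^+ 2]. Hence [x = r ^+ 2] and [y] is [s ^+ 2] up to sign, and [r ^+ 2 + s ^+ 2],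
    [r ^+ 2 - s ^+ 2] are [a ^+ 2] and [b ^+ 2] in some order. *)
Lemma exp4_sub_sqr (a b c : int) :
  coprimez a b -> coprimez a 2 -> coprimez b 2 ->
  a ^+ 4 - b ^+ 4 = c ^+ 2 -> c = 0.
Proof.
move=> hab ha hb e.
have odd x : coprimez x 2 -> exists j, x ^+ 2 = 8 * j + 1.
  have [y [->|->]] := parity x; last by move=> _; apply: odd_sqr.
  by case/coprimezP=> -[u v] /= ; clear; lia.
have [i ei] := odd _ ha; have [j ej] := odd _ hb.
have eab : a ^+ 4 - b ^+ 4 = 16 * (4 * (i + j) + 1) * (i - j).
  transitivity ((a ^+ 2) ^+ 2 - (b ^+ 2) ^+ 2); first by ring.
  by rewrite ei ej; ring.
have [d ed] : exists d, c = 2 * d.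
  have [d [ed|ed]] := parity c; first by exists d.
  have [l el] := odd_sqr d; rewrite -ed in el.
  by rewrite eab el in e; clear -e; lia.
set x := 4 * (i + j) + 1 in eab; set y := 4 * (i - j).
have exy : x * y = d ^+ 2.
  by rewrite eab ed in e; clear -e; rewrite /x /y in e *; lia.
have ex : a ^+ 2 = x + y by rewrite ei /x /y; ring.
have ey : b ^+ 2 = x - y by rewrite ej /x /y; ring.
have cxy : coprimez x y.
  have : coprimez (a ^+ 2) (b ^+ 2) by apply/coprimezXl/coprimezXr.
  case/coprimezP=> -[u v] /= h; apply/coprimezP; exists (u + v, u - v) => /=.
  by apply: (eq_trans _ h); rewrite ex ey; ring.
have x0 : 0 <= x.
  by have := sqr_ge0 a; have := sqr_ge0 b; clear -ex ey; lia.
have [r er] := coprimez_mul_sqr_ge0 x0 cxy exy.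
have [s es] : exists s, y = s ^+ 2 \/ y = - s ^+ 2.
  by apply: (@coprimez_mul_exp 2 y x d); rewrite 1?coprimez_sym 1?mulrC.
have s0 : s = 0.
  have crs : coprimez r s.
    by move: cxy; rewrite er; case: es => ->; rewrite ?coprimezN coprimez_pexpl // coprimez_pexpr.
  rewrite er in ex ey; case: es => es; rewrite es in ex ey.
    exact: (one_not_congruent crs (esym ex) (esym ey)).
  by apply: (one_not_congruent crs (a := b) (b := a)); rewrite ?ex ?ey ?opprK.
have y0 : y = 0 by case: es => ->; rewrite s0 expr0n.
move: exy; rewrite y0 mulr0 => /esym/eqP; rewrite sqrf_eq0 => /eqP d0.
by rewrite ed d0 mulr0.
Qed.

(** Squaring gives [w ^+ 4 - (x * y) ^+ 4 = c ^+ 2] with [c = (x ^+ 4 - y ^+ 4) / 2], so [c = 0] by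
    [exp4_sub_sqr]. *)
Lemma exp4_add_double_sqr (x y w : int) :
  coprimez x y -> x ^+ 4 + y ^+ 4 = 2 * w ^+ 2 -> x ^+ 2 = y ^+ 2.
Proof.
move=> hxy e.
have [x' [y' [ex ey]]] : exists x' y', x = 2 * x' + 1 /\ y = 2 * y' + 1.
  have [x' [ex|ex]] := parity x; have [y' [ey|ey]] := parity y;
    last by exists x', y'.
  - by move: hxy => /coprimezP[[u v] /=]; rewrite ex ey; clear; lia.
  - by rewrite ex ey in e; clear -e; lia.
  - by rewrite ex ey in e; clear -e; lia.
have [i ei] := odd_sqr x'; have [j ej] := odd_sqr y'; rewrite -ex -?ey in ei ej.
have e4 : x ^+ 4 + y ^+ 4 = (8 * i + 1) ^+ 2 + (8 * j + 1) ^+ 2.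
  by rewrite -ei -ej -!exprM.
have cw2 : coprimez w 2.
  have [w' [ew|ew]] := parity w; last by rewrite ew coprimez_2.
  by rewrite ew e4 in e; clear -e; lia.
have cxw : coprimez (x * y) w.
  rewrite coprimezMl -(@coprimez_pexpr 2 x) // -(@coprimez_pexpr 2 y) //.
  apply/andP; split.
    apply: (@coprimez_lincomb _ _ (y ^+ 4) (- x ^+ 3) 2); first by rewrite coprimez_pexpr.
    by rewrite -e; ring.
  apply: (@coprimez_lincomb _ _ (x ^+ 4) (- y ^+ 3) 2).
    by rewrite coprimez_pexpr // coprimez_sym.
  by rewrite -e; ring.
pose c := 32 * i ^+ 2 + 8 * i - 32 * j ^+ 2 - 8 * j.
have ec : x ^+ 4 - y ^+ 4 = 2 * c.
  transitivity ((x ^+ 2) ^+ 2 - (y ^+ 2) ^+ 2); first by ring.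
  by rewrite ei ej /c; ring.
apply: exp4_sqr; apply/eqP; rewrite -subr_eq0 ec.
have -> : c = 0; last by rewrite mulr0.
apply: (@exp4_sub_sqr w (x * y)) => //; first by rewrite coprimez_sym.
  by rewrite coprimezMl ex ey !coprimez_2.
have e1 : 4 * w ^+ 4 = (x ^+ 4 + y ^+ 4) ^+ 2 by rewrite e; ring.
have e2 : 4 * c ^+ 2 = (x ^+ 4 - y ^+ 4) ^+ 2 by rewrite ec; ring.
apply: (@mulfI _ (4 : int)) => //.
by rewrite mulrBr e1 e2; ring.
Qed.

(* Descent: (|x| + 1) / 2 = g^4 and (|x| - 1) / 2 = c h^4, then
   (g^2 + 1) / 2 = ga^4 and (g^2 - 1) / 8 = c d^4, so (ga^2, d) is a smaller
   solution. *)
Lemma pell_exp4 (c x k : int) :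
  c = 3 \/ c = 27 -> x ^+ 2 - 4 * c * k ^+ 4 = 1 -> k = 0.
Proof.
move=> hc; have [n] := ubnP `|k|%N; elim: n x k => // n IH x k hk ex.
have [->//|k0] := eqVneq k 0.
(* Since [c] is a power of 3, it goes entirely into one of two coprime factors. *)
have c3 y : coprimez 3 y -> coprimez c y.
  by case: hc => -> // h; apply: (coprimezXl 3 h).
have [e ee] : exists e, `|x| = 2 * e + 1.
  have [e [ee|ee]] := parity `|x|; last by exists e.
  have : `|x| ^+ 2 = x ^+ 2 by rewrite real_normK ?num_real.
  by rewrite ee; clear -ex; lia.
have e0 : 0 <= e by have := normr_ge0 x; clear -ee; lia.
have e1 : e * (e + 1) = c * k ^+ 4.
  have : `|x| ^+ 2 = x ^+ 2 by rewrite real_normK ?num_real.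
  by rewrite ee; clear -ex; lia.
have ce : coprimez e (e + 1) by apply/coprimezP; exists (-1, 1) => /=; ring.
have [f [g [h [ef eg eh]]]] :
    exists f g h, [/\ e = c * f, e + 1 = g ^+ 4 & f = h ^+ 4].
  have [h3|[y ey]] := coprimez_3 (e + 1).
    have [f ef] := dvdz_mul_ex (c3 _ h3) e1.
    have f0 : 0 <= f by clear -hc e0 ef; case: hc ef => ->; lia.
    have e2 : f * (e + 1) = k ^+ 4.
      rewrite {1}ef in e1; apply: (@mulfI _ c); last by rewrite -e1; ring.
      by case: hc => ->.
    have cf : coprimez f (e + 1) by move: ce; rewrite {1}ef coprimezMl => /andP[].
    have e10 : 0 <= e + 1 by rewrite addr_ge0.
    have [h [g [eh eg]]] := coprimez_mul_exp_ge0 f0 e10 cf e2.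
    by exists f, g, h.
  (* If 3 divides [e + 1], then [e] is a fourth power congruent to -1 modulo 3, which is
     impossible. *)
  have c3e : coprimez c e.
    by apply: c3; apply/coprimezP; exists (y, -1) => /=; rewrite mulrC -ey; ring.
  have [f ef] := @dvdz_mul_ex c (e + 1) e (k ^+ 4) c3e (etrans (mulrC _ _) e1).
  have f0 : 0 <= f by clear -hc e0 ef; case: hc ef => ->; lia.
  have e2 : e * f = k ^+ 4.
    rewrite ef in e1; apply: (@mulfI _ c); last by rewrite -e1; ring.
    by case: hc => ->.
  have cf : coprimez e f by move: ce; rewrite ef coprimezMr => /andP[].
  have [g [_ [eg _]]] := coprimez_mul_exp_ge0 e0 f0 cf e2.
  have [j ej] := sqr_mod3 g.
  have g4 : g ^+ 4 = (g ^+ 2) ^+ 2 by rewrite -exprM.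
  by exfalso; clear -ej eg g4 ey; case: ej => ej; rewrite ej in g4; lia.
have egh : g ^+ 4 - c * h ^+ 4 = 1 by rewrite -eg -eh -ef; ring.
have ek : k ^+ 4 = h ^+ 4 * g ^+ 4.
  apply: (@mulfI _ c); first by case: hc => ->.
  by rewrite -e1 eg ef eh; ring.
have [j ej] : exists j, g ^+ 2 = 8 * j + 1.
  have [g' [g2|g2]] := parity g; last by rewrite g2; apply: odd_sqr.
  have [h' [h2|h2]] := parity h; first by rewrite g2 h2 in egh; clear -egh; lia.
  have [l el] := odd_sqr h'; rewrite -h2 in el.
  have h4 : h ^+ 4 = (h ^+ 2) ^+ 2 by rewrite -exprM.
  rewrite h4 el g2 in egh; exfalso; clear -egh hc.
  by case: hc egh => ->; lia.
have g4 : g ^+ 4 = 16 * (j * (4 * j + 1)) + 1.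
  by transitivity ((g ^+ 2) ^+ 2); [rewrite -exprM | rewrite ej; ring].
have [h' h2] : exists h', h = 2 * h'.
  have [h' [h2|h2]] := parity h; first by exists h'.
  by rewrite g4 h2 in egh; exfalso; clear -egh hc; case: hc egh => ->; lia.
have ej' : j * (4 * j + 1) = c * h' ^+ 4.
  by rewrite g4 h2 in egh; clear -egh hc; case: hc egh => ->; lia.
have cj : coprimez j (4 * j + 1) by apply/coprimezP; exists (-4, 1) => /=; ring.
have j0 : 0 <= j by have := sqr_ge0 g; rewrite ej; clear; lia.
have c3j : coprimez c (4 * j + 1).
  apply: c3; have [//|[y ey]] := coprimez_3 (4 * j + 1).
  by have [l el] := sqr_mod3 g; exfalso; clear -el ey ej; lia.
have [f' ef'] := dvdz_mul_ex c3j ej'.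
have f'0 : 0 <= f' by clear -hc j0 ef'; case: hc ef' => ->; lia.
have e2 : f' * (4 * j + 1) = h' ^+ 4.
  rewrite {1}ef' in ej'; apply: (@mulfI _ c); last by rewrite -ej'; ring.
  by case: hc => ->.
have cf' : coprimez f' (4 * j + 1) by move: cj; rewrite {1}ef' coprimezMl => /andP[].
have j10 : 0 <= 4 * j + 1 by clear -j0; lia.
have [d [ga [ed ega]]] := coprimez_mul_exp_ge0 f'0 j10 cf' e2.
have ek' : k ^+ 4 = d ^+ 4 * (16 * (g * ga) ^+ 4).
  by rewrite ek h2 exprMn -e2 ed ega; ring.
have k40 : 0 < k ^+ 4 by rewrite exprn_even_gt0.
have d0 : d != 0.
  by apply: contraTneq k40 => d0; rewrite ek' d0 expr0n mul0r ltxx.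
have d40 : 0 < d ^+ 4 by rewrite exprn_even_gt0.
case/eqP: d0; apply: (IH (ga ^+ 2) d).
  apply: leq_trans (hk : (`|k| <= n)%N); apply: ltn_absz_exp4.
  rewrite ek' in k40 *; rewrite pmulr_rgt0 // in k40.
  by rewrite ltr_pMr //; clear -k40; lia.
by rewrite -exprM -ega -ed ef'; ring.
Qed.

(* Descent: factoring k^2 - (h^2 - a^2)^2 = 3 a^4 gives a = 2 u v (up to sign)
   with v^2 + 6 u^2 and v^2 - 2 u^2 squares; then u = p q with (v, q, p) a
   smaller solution. *)
Lemma quartic_descent (k h a : int) :
  coprimez h 2 -> coprimez h a ->
  k ^+ 2 = h ^+ 4 - 2 * a ^+ 2 * h ^+ 2 + 4 * a ^+ 4 -> a = 0.
Proof.
have [n] := ubnP `|a|%N; elim: n k h a => // n IH k h a hn h2 hha ek.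
have [->//|a0] := eqVneq a 0.
have [h' eh] : exists h', h = 2 * h' + 1.
  have [h' [e|e]] := parity h; last by exists h'.
  by move: h2; rewrite e => /coprimezP[[u v] /=]; clear; lia.
have [i ei] := odd_sqr h'; rewrite -eh in ei.
have h4 : h ^+ 4 = (8 * i + 1) ^+ 2 by rewrite -ei -exprM.
have [k' ek'] : exists k', k = 2 * k' + 1.
  have [k' [e|e]] := parity k; last by exists k'.
  by rewrite h4 ei e in ek; exfalso; clear -ek; lia.
have [l el] := odd_sqr k'; rewrite -ek' in el.
have [al eal] : exists al, a = 2 * al.
  have [al [e|e]] := parity a; first by exists al.
  have [j ej] := odd_sqr al; rewrite -e in ej.
  have a4 : a ^+ 4 = (8 * j + 1) ^+ 2 by rewrite -ej -exprM.
  by rewrite h4 a4 ei ej el in ek; exfalso; clear -ek; lia.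
have [w ew] : exists w, `|k| = 2 * w + 1.
  by case: (ger0P k) => _; [exists k' | exists (- k' - 1)]; rewrite ek' //; ring.
pose x := w - 2 * al ^+ 2 + 4 * i + 1; pose y := w + 2 * al ^+ 2 - 4 * i.
have exy : x - y = h ^+ 2 - 4 * al ^+ 2 by rewrite ei /x /y; ring.
have exk : x + y = `|k| by rewrite ew /x /y; ring.
have xy : x * y = 12 * al ^+ 4.
  apply: (@mulfI _ (4 : int)) => //.
  transitivity ((x + y) ^+ 2 - (x - y) ^+ 2); first by ring.
  by rewrite exk exy real_normK ?num_real // ek eal; ring.
have cha : coprimez h al by move: hha; rewrite eal coprimezMr => /andP[].
(* The gcd [g] is prime to [al], so [g ^+ 2] divides 12, and it is odd because [x + y] is the odd
   number [|k|]. *)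
have cxy : coprimez x y.
  pose g := gcdz x y.
  have [/dvdzP[x1 ex1] /dvdzP[y1 ey1]] : (g %| x)%Z /\ (g %| y)%Z by rewrite dvdz_gcdl dvdz_gcdr.
  have cga : coprimez g al.
    rewrite coprimez_sym; apply: (@coprimez_lincomb _ _ (h ^+ 2) (4 * al) (x1 - y1)).
      by rewrite coprimezXr // coprimez_sym.
    by rewrite mulrBl -ex1 -ey1 exy; ring.
  have [f ef] : exists f, 12 = g ^+ 2 * f.
    apply: (@dvdz_mul_ex (g ^+ 2) 12 (al ^+ 4) (x1 * y1)).
      by apply/coprimezXl/coprimezXr.
    by rewrite -xy {1}ex1 {1}ey1; ring.
  have [g' eg] : exists g', g = 2 * g' + 1.
    have [g' [e|e]] := parity g; last by exists g'.
    have : `|k| = g * (x1 + y1) by rewrite -exk {1}ex1 {1}ey1; ring.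
    by rewrite ew e; clear; lia.
  have g0 : 0 <= g by [].
  have : g = 1.
    rewrite eg in ef g0 *; clear -ef g0.
    have [g1|g1] : g' = 0 \/ 1 <= g' by lia.
      by rewrite g1.
    have f1 : f = 1 by nia.
    by rewrite f1 in ef; lia.
  by move=> g1; rewrite /coprimez -/g g1.
have x0 : 0 <= x /\ 0 <= y.
  have k0 := normr_ge0 k; have al4 : 0 <= al ^+ 4 by rewrite exprn_even_ge0.
  by clearbody x y; rewrite -exk in k0; clear -k0 xy al4; nia.
case: x0 => x0 y0.
(* In [x * y = 12 * al ^+ 4] the even factor takes all of 4, while 3 may go to either side. *)
have [u [v [ealp hx]]] : exists u v, al ^+ 4 = u ^+ 4 * v ^+ 4 /\
    [\/ x = 12 * u ^+ 4 /\ y = v ^+ 4, x = v ^+ 4 /\ y = 12 * u ^+ 4,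
        x = 4 * u ^+ 4 /\ y = 3 * v ^+ 4 | x = 3 * v ^+ 4 /\ y = 4 * u ^+ 4].
  have key X Y : 0 <= X -> 0 <= Y -> coprimez (2 * X) Y -> coprimez Y 2 ->
      2 * X * Y = 12 * al ^+ 4 -> exists u v, al ^+ 4 = u ^+ 4 * v ^+ 4 /\
      (2 * X = 12 * u ^+ 4 /\ Y = v ^+ 4 \/ 2 * X = 4 * u ^+ 4 /\ Y = 3 * v ^+ 4).
    move=> X0 Y0 cXY cY e.
    have [Z eZ] : exists Z, X = 2 * Z.
      apply: (@dvdz_mul_ex 2 X Y (3 * al ^+ 4)); first by rewrite coprimez_sym.
      by clear -e; lia.
    have eZY : Z * Y = 3 * al ^+ 4 by rewrite eZ in e; clear -e; lia.
    have cZY : coprimez Z Y by move: cXY; rewrite eZ !coprimezMl => /andP[_ /andP[]].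
    have [h3|[V eV]] := coprimez_3 Y.
      have [U eU] := dvdz_mul_ex h3 eZY.
      have [|||| u [v [eu ev]]] := @coprimez_mul_exp_ge0 4 U Y al.
      - by clear -eU eZ X0; lia.
      - by [].
      - by move: cZY; rewrite eU coprimezMl => /andP[].
      - by rewrite eU in eZY; clear -eZY; lia.
      exists u, v; rewrite -eu -ev; split; first by rewrite eU in eZY; clear -eZY; lia.
      by left; split=> //; rewrite eZ eU; ring.
    have [|||| u [v [eu ev]]] := @coprimez_mul_exp_ge0 4 Z V al.
    - by clear -eZ X0; lia.
    - by clear -eV Y0; lia.
    - by move: cZY; rewrite eV coprimezMr => /andP[].
    - by rewrite eV in eZY; clear -eZY; lia.
    exists u, v; rewrite -eu -ev; split; first by rewrite eV in eZY; clear -eZY; lia.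
    by right; split=> //; rewrite eZ; ring.
  have [X [eX|eX]] := parity x.
    have [Y [eY|eY]] := parity y.
      by move: cxy; rewrite eX eY => /coprimezP[[u v] /=]; clear; lia.
    have [|||||u [v [e H]]] := key X y; rewrite -?eX //; first by clear -eX x0; lia.
      by rewrite eY coprimez_2.
    by exists u, v; split=> //; case: H => -[]; rewrite -eX => -> ->; [apply: Or41 | apply: Or43].
  have [Y [eY|eY]] := parity y; last first.
    by rewrite ew eX eY in exk; exfalso; clear -exk; lia.
  have [|||||u [v [e H]]] := key Y x; rewrite -?eY //; first by clear -eY y0; lia.
  - by rewrite coprimez_sym.
  - by rewrite eX coprimez_2.
  - by rewrite mulrC.
  by exists u, v; split=> //; case: H => -[]; rewrite -eY => -> ->; [apply: Or42 | apply: Or44].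
have eal2 : al ^+ 2 = u ^+ 2 * v ^+ 2.
  by rewrite -exprMn; apply: exp4_sqr; rewrite ealp exprMn.
have eh2 : 8 * i + 1 = x - y + 4 * (u ^+ 2 * v ^+ 2) by rewrite exy ei eal2; ring.
have [v' ev] : exists v', v = 2 * v' + 1.
  have [v' [e|e]] := parity v; last by exists v'.
  by exfalso; case: hx eh2 => -[-> ->]; rewrite e; clear; lia.
have [j ej] := odd_sqr v'; rewrite -ev in ej.
have v4 : v ^+ 4 = (8 * j + 1) ^+ 2 by rewrite -ej -exprM.
(* The odd square [h ^+ 2 = x - y + 4 * u ^+ 2 * v ^+ 2] is 1 modulo 8, and the other three cases
   give 7, 5 and 3. *)
have {hx} [xe ye] : x = v ^+ 4 /\ y = 12 * u ^+ 4.
  case: hx => // -[ex ey]; rewrite ex ey v4 ej in eh2; exfalso; clear -eh2; first by lia.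
    have [u' [eu|eu]] := parity u; first by rewrite eu in eh2; lia.
    have [m em] := odd_sqr u'; rewrite -eu in em.
    have u4 : u ^+ 4 = (8 * m + 1) ^+ 2 by rewrite -em -exprM.
    by rewrite u4 em in eh2; lia.
  by lia.
have cuv : coprimez u v.
  move: cxy; rewrite xe ye coprimezMr => /andP[_].
  by rewrite coprimez_pexpl // coprimez_pexpr // coprimez_sym.
have ePQ : (v ^+ 2 + 6 * u ^+ 2) * (v ^+ 2 - 2 * u ^+ 2) = h ^+ 2.
  by rewrite ei eh2 xe ye; ring.
have P0 : 0 <= v ^+ 2 + 6 * u ^+ 2.
  by have := sqr_ge0 v; have := sqr_ge0 u; clear; lia.
have cPQ : coprimez (v ^+ 2 + 6 * u ^+ 2) (v ^+ 2 - 2 * u ^+ 2).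
  apply: (@coprimez_lincomb _ _ (8 * u ^+ 2) 1 (-1)); last by ring.
  rewrite coprimezMr; apply/andP; split.
    have -> : v ^+ 2 + 6 * u ^+ 2 = 2 * (4 * j + 3 * u ^+ 2) + 1 by rewrite ej; ring.
    exact: (coprimezXr 3 (coprimez_2 _)).
  rewrite coprimez_sym.
  apply: (@coprimez_lincomb _ _ (v ^+ 2) (-6) 1); last by ring.
  by apply/coprimezXl/coprimezXr.
have h20 : 0 < h ^+ 2 by rewrite exprn_even_gt0 //= eh; clear; lia.
have Q0 : 0 <= v ^+ 2 - 2 * u ^+ 2.
  by rewrite -ePQ in h20; clear -h20 P0; nia.
have [_ [X [_ eX]]] := coprimez_mul_exp_ge0 P0 Q0 cPQ ePQ.
have [Y [_ [eY _]]] := coprimez_mul_exp_ge0 P0 Q0 cPQ ePQ.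
(* From [Y ^+ 2 - X ^+ 2 = 8 * u ^+ 2], the half difference [f] and half sum [g] of [Y] and [X]
   satisfy [f * g = 2 * u ^+ 2] and [f ^+ 2 - f * g + g ^+ 2 = v ^+ 2]. Up to sign the even one is
   [2 * p ^+ 2] and the odd one [q ^+ 2], which reproduces the original quartic. *)
have [p [q [hpq cqp q2 ev2]]] : exists p q, [/\ u ^+ 2 = p ^+ 2 * q ^+ 2,
    coprimez q p, coprimez q 2 & v ^+ 2 = q ^+ 4 - 2 * p ^+ 2 * q ^+ 2 + 4 * p ^+ 4].
  have key F G : F + G = Y -> F * G = 2 * u ^+ 2 -> v ^+ 2 = F ^+ 2 - F * G + G ^+ 2 ->
      (exists F', F = 2 * F') -> exists p q, [/\ u ^+ 2 = p ^+ 2 * q ^+ 2,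
    coprimez q p, coprimez q 2 & v ^+ 2 = q ^+ 4 - 2 * p ^+ 2 * q ^+ 2 + 4 * p ^+ 4].
    move=> FGY FG eFG [F' eF].
    have cG : coprimez G 2.
      have [G' [e|e]] := parity G; last by rewrite e coprimez_2.
      by exfalso; rewrite -FGY eF e ej in eY; clear -eY; lia.
    have cFG : coprimez F' G.
      have [[c d] /= cd] : exists w, w.1 * u ^+ 2 + w.2 * v ^+ 2 = 1.
        by apply/coprimezP/coprimezXl/coprimezXr.
      have : coprimez G F.
        apply: (@coprimez_lincomb _ _ 2 (c * F + 2 * d * (G - F)) (2 * d * F)) => //.
        transitivity (c * (F * G) + 2 * d * (F ^+ 2 - F * G + G ^+ 2)); first by ring.
        rewrite -eFG FG.
        by transitivity (2 * (c * u ^+ 2 + d * v ^+ 2)); [ring | rewrite cd mulr1].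
      by rewrite eF coprimezMr => /andP[_]; rewrite coprimez_sym.
    have eu : F' * G = u ^+ 2 by rewrite eF in FG; clear -FG; lia.
    have [p hp] := coprimez_mul_exp cFG eu.
    have [q hq] : exists q, G = q ^+ 2 \/ G = - q ^+ 2.
      by apply: (@coprimez_mul_exp 2 G F' u); rewrite 1?coprimez_sym // mulrC.
    have cqp : coprimez q p.
      move: cFG; rewrite coprimez_sym.
      by case: hq hp => -> [->|->]; rewrite ?coprimezN ?coprimeNz coprimez_pexpl // coprimez_pexpr.
    have cq2 : coprimez q 2.
      by move: cG; case: hq => ->; rewrite ?coprimeNz coprimez_pexpl.
    have pq0 : 0 <= p ^+ 2 * q ^+ 2 by rewrite mulr_ge0 ?sqr_ge0.
    have u20 := sqr_ge0 u.
    have e1 : u ^+ 2 = p ^+ 2 * q ^+ 2.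
      by case: hp eu => ->; case: hq => ->; clear -pq0 u20; lia.
    exists p, q; split=> //.
    have {}FG : F * G = 2 * (p ^+ 2 * q ^+ 2) by rewrite FG e1.
    have F2 : F ^+ 2 = 4 * p ^+ 4 by rewrite eF; case: hp => ->; ring.
    have G2 : G ^+ 2 = q ^+ 4 by case: hq => ->; ring.
    by rewrite eFG FG F2 G2; ring.
  have [X' eX'] : exists X', X = 2 * X' + 1.
    have [z [e|e]] := parity X; last by exists z.
    by exfalso; rewrite e ej in eX; clear -eX; lia.
  have [Y' eY'] : exists Y', Y = 2 * Y' + 1.
    have [z [e|e]] := parity Y; last by exists z.
    by exfalso; rewrite e ej in eY; clear -eY; lia.
  pose f := Y' - X'; pose g := Y' + X' + 1.
  have fgY : f + g = Y by rewrite eY' /f /g; ring.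
  have fgX : g - f = X by rewrite eX' /f /g; ring.
  have fg : f * g = 2 * u ^+ 2.
    apply: (@mulfI _ (4 : int)) => //.
    transitivity ((f + g) ^+ 2 - (g - f) ^+ 2); first by ring.
    by rewrite fgY fgX -eY -eX; ring.
  have fgv : v ^+ 2 = f ^+ 2 - f * g + g ^+ 2.
    transitivity ((g - f) ^+ 2 + f * g); last by ring.
    by rewrite fgX -eX fg; ring.
  have [z [e|e]] := parity f; first by apply: (key f g) => //; exists z.
  apply: (key g f); rewrite 1?addrC // 1?mulrC //.
    by rewrite fgv; ring.
  by exists (Y' - z); clear -fgY e eY'; lia.
have ea : a ^+ 2 = p ^+ 2 * (4 * (q * v) ^+ 2).
  by rewrite eal exprMn eal2 hpq; ring.
have a20 : 0 < a ^+ 2 by rewrite exprn_even_gt0.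
have p0 : p != 0.
  by apply: contraTneq a20 => p0; rewrite ea p0 expr0n mul0r ltxx.
have p20 : 0 < p ^+ 2 by rewrite exprn_even_gt0.
case/eqP: p0; apply: (IH v q p) => //.
apply: leq_trans (hn : (`|a| <= n)%N); apply: ltn_absz_sqr.
rewrite ea in a20 *; rewrite pmulr_rgt0 // in a20.
by rewrite ltr_pMr //; clear -a20; lia.
Qed.

(** * Halving quartics of the integral points *)

(* If (x / d^2, y / d^3) = 2 W, the tangent at W meets the curve again at
   (x / d^2, - y / d^3); s is d times its slope. *)
Definition halving_quartic (a x y d s : int) : int :=
  s ^+ 4 - 6 * x * s ^+ 2 - 8 * y * s - 3 * x ^+ 2 - 4 * a * d ^+ 4.

Lemma dvdz_unit (s t e : int) : s * t = e -> e ^+ 2 = 1 -> s = 1 \/ s = -1.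
Proof.
move=> st e1; have : (s %| e ^+ 2)%Z by rewrite -st exprMn -mulrA dvdz_mulr.
by rewrite e1 dvdzE dvdn1 => /eqP; clear; lia.
Qed.

Lemma dvdz_3 (d : int) :
  (d %| 3)%Z -> [\/ d = 1, d = -1, d = 3 | d = -3].
Proof.
have /primeP[_ h3] : prime 3 by [].
rewrite dvdzE => /h3 /orP[]/eqP d3; case: (ger0P d) => d0.
- by apply: Or41; lia.
- by apply: Or42; lia.
- by apply: Or43; lia.
- by apply: Or44; lia.
Qed.

(** The value [s ^+ 4 - 8 * n * s + 4] is odd for odd [s] and 4 modulo 8 for even [s]. *)
Lemma halving_quartic_P1 (n s : int) : halving_quartic (-1) 0 n 1 s != 0.
Proof.
apply/eqP; rewrite /halving_quartic => e.
have [r [er|er]] := parity s; last first.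
  have [j ej] := odd_sqr r; rewrite -er in ej.
  have s4 : s ^+ 4 = (8 * j + 1) ^+ 2 by rewrite -ej -exprM.
  by rewrite s4 in e; clear -e; lia.
by rewrite er in e; clear -e; lia.
Qed.

Lemma halving_quartic_P2 (n s : int) : halving_quartic (-1) 1 n 1 s != 0.
Proof.
apply/eqP; rewrite /halving_quartic => e.
have [r [er|er]] := parity s; last first.
  have [j ej] := odd_sqr r; rewrite -er in ej.
  have s4 : s ^+ 4 = (8 * j + 1) ^+ 2 by rewrite -ej -exprM.
  by rewrite s4 ej in e; clear -e; lia.
by rewrite er in e; clear -e; lia.
Qed.

(** The constant term of [s ^+ 4 + 6 * s ^+ 2 + 8 * n * s + 1] forces [s] to be 1 or -1, and -1 is a
    root only for [n = 1]. *)
Lemma halving_quartic_P1P2 (n s : int) : 1 < n -> halving_quartic (-1) (-1) (- n) 1 s != 0.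
Proof.
move=> n1; apply/eqP; rewrite /halving_quartic => e.
have [||es|es] := @dvdz_unit s (s ^+ 3 + 6 * s + 8 * n) (-1) => //.
- by clear -e; lia.
- by rewrite es in e; clear -e n1; lia.
- by rewrite es in e; clear -e n1; lia.
Qed.

(* Multiplied by m^4, the equation is quadratic in m^4 once p = m s is fixed. *)
Lemma halving_quartic_P3 (m s : int) : 1 < m -> halving_quartic (-1) (- m ^+ 2) (- m) 1 s != 0.
Proof.
move=> m1; apply/eqP; rewrite /halving_quartic => e.
pose p := m * s; pose q := p ^+ 2 + p.
have [r er] : exists r, q = 2 * r.
  have [p' [ep|ep]] := parity p.
    by exists (p' * (2 * p' + 1)); rewrite /q ep; ring.
  by exists ((2 * p' + 1) * (p' + 1)); rewrite /q ep; ring.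
have q0 : 0 <= q by rewrite /q; clear; nia.
(* In [M = m ^+ 4] the equation reads [3 * M ^+ 2 - 2 * (3 * p ^+ 2 + 4 * p + 2) * M - p ^+ 4 = 0],
   and [V ^+ 2] is a quarter of its discriminant. *)
pose V := 3 * m ^+ 4 - (3 * p ^+ 2 + 4 * p + 2).
have eV : V ^+ 2 = 4 * ((3 * q + 1) * (q + 1)).
  apply/eqP; rewrite -subr_eq0; apply/eqP.
  transitivity (- 3 * m ^+ 4 * (s ^+ 4 - 6 * (- m ^+ 2) * s ^+ 2 - 8 * (- m) * s
    - 3 * (- m ^+ 2) ^+ 2 - 4 * -1 * 1 ^+ 4)).
    by rewrite /V /q /p; ring.
  by rewrite e mulr0.
have [W eW] : exists W, V = 2 * W.
  have [W [w|w]] := parity V; first by exists W.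
  by rewrite w in eV; exfalso; clear -eV; lia.
have eW2 : (q + 1) * (3 * q + 1) = W ^+ 2 by rewrite eW in eV; clear -eV; lia.
have [|||d [_ [ed _]]] := coprimez_mul_exp_ge0 _ _ _ eW2; try by clear -q0; lia.
  apply: (@coprimez_lincomb _ _ 2 3 (-1)); last by ring.
  by rewrite er coprimez_2.
(* As [4 * (q + 1) = (2 * p + 1) ^+ 2 + 3], the square [q + 1 = d ^+ 2] writes 3 as a difference of
   two squares. *)
have p01 : p = 0 \/ p = -1.
  have ed' : (2 * `|d| - `|2 * p + 1|) * (2 * `|d| + `|2 * p + 1|) = 3.
    transitivity (4 * `|d| ^+ 2 - `|2 * p + 1| ^+ 2); first by ring.
    by rewrite !real_normK ?num_real // -ed /q; ring.
  have d0 := normr_ge0 d; have p0 := normr_ge0 (2 * p + 1).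
  have pd : `|2 * p + 1| < 2 * `|d|.
    by move: `|d| `|_| d0 p0 ed' => D P; clear; nia.
  have p1 : `|2 * p + 1| <= 1.
    by move: `|d| `|_| d0 p0 pd ed' => D P; clear; nia.
  by clear -p1; lia.
case: p01 => ep.
  have m0 : m != 0 by clear -m1; lia.
  move/eqP: ep; rewrite mulf_eq0 (negPf m0) /= => /eqP s0.
  by rewrite s0 in e; clear -e; lia.
have [//|em|em] := dvdz_unit (ep : m * s = -1); by clear -em m1; lia.
Qed.

(** The value is odd for even [s]. For odd [s] it is 8 modulo 16 if [m] is even, and 4 modulo 16 if
    [m] is odd. *)
Lemma halving_quartic_P2P3 (m s : int) :
  halving_quartic (-1) (2 * m ^+ 2 - 1) (2 * m - 3 * m ^+ 3) 1 s != 0.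
Proof.
apply/eqP; rewrite /halving_quartic => e.
have [r [er|er]] := parity s; first by rewrite er in e; clear -e; lia.
have [j ej] := odd_sqr r; rewrite -er in ej.
have s4 : s ^+ 4 = (8 * j + 1) ^+ 2 by rewrite -ej -exprM.
have [t [et|et]] := parity m.
  by rewrite s4 ej et in e; clear -e; lia.
have [i ei] := odd_sqr t; rewrite -et in ei.
have m3 : m ^+ 3 = m * (8 * i + 1) by rewrite -ei -exprS.
by rewrite s4 ej m3 ei er et in e; clear -e; lia.
Qed.

(** As [(n ^+ 2, n ^+ 3)] lies on the cuspidal cubic y^2 = x^3, the quartic degenerates to
    [t ^+ 3 * (t - 4 * n) - 4] with [t = s + n]. Even [t] makes the product divisible by 16; odd [t]
    must be 1 or -1. *)
Lemma halving_quartic_Q1 (n s : int) : 1 < n -> halving_quartic 1 (n ^+ 2) (n ^+ 3) 1 s != 0.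
Proof.
move=> n1; apply/eqP; rewrite /halving_quartic => e.
pose t := s + n.
have [r [er|er]] := parity t.
  have : t ^+ 3 * (t - 4 * n) = 4 by rewrite /t; clear -e; lia.
  by rewrite er; clear; lia.
have et : t * (t ^+ 2 * (t - 4 * n)) = 4 by rewrite /t; clear -e; lia.
have c4t : coprimez 4 t.
  by rewrite coprimez_sym er; apply: (coprimezXr 2 (coprimez_2 r)).
have [f ef] : exists f, t ^+ 2 * (t - 4 * n) = 4 * f.
  by apply: (dvdz_mul_ex c4t (z := 1)); rewrite mulrC et.
rewrite ef in et; have tf : t * f = 1 by clear -et; lia.
have [//|t1|t1] := dvdz_unit tf; rewrite t1 in ef tf; first by clear -ef tf n1; lia.
by clear -ef tf n1; lia.
Qed.

(** The value is odd if [s] and [m] have different parities, and 4 modulo 8 otherwise. *)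
Lemma halving_quartic_Q2 (m s : int) : halving_quartic 1 (m ^+ 2) m 1 s != 0.
Proof.
apply/eqP; rewrite /halving_quartic => e.
have [r [er|er]] := parity s; have [t [et|et]] := parity m;
  rewrite er et in e; clear -e; lia.
Qed.

(* Homogenised by w, the quartic is quadratic in w^2; its discriminant factors
   as 8 t (t + m) (t^2 + t m + m^2) with t = s + m, and must be a square. *)
Lemma halving_quartic_P1P2P3 (m s : int) : 1 < m ->
  halving_quartic (-1) (2 * m ^+ 2 + 1) (3 * m ^+ 3 + 2 * m) 1 s != 0.
Proof.
move=> m1; apply/eqP; rewrite /halving_quartic => e.
pose t := s + m.
have ems : s ^+ 4 - 12 * m ^+ 2 * t ^+ 2 - 6 * s ^+ 2 - 16 * m * s - 12 * m ^+ 2 + 1 = 0.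
  by apply: (eq_trans _ e); rewrite /t; ring.
have [r er] : exists r, s = 2 * r + 1.
  have [r [er|er]] := parity s; last by exists r.
  by rewrite er in ems; exfalso; clear -ems; lia.
have [j ej] := odd_sqr r; rewrite -er in ej.
have s4 : s ^+ 4 = (8 * j + 1) ^+ 2 by rewrite -ej -exprM.
have [i ei] : exists i, m = 2 * i + 1.
  have [i [ei|ei]] := parity m; last by exists i.
  by rewrite s4 ej ei in ems; exfalso; clear -ems; lia.
(* A common divisor of [t] and [m] divides [s], hence every term of [ems] except the constant 1; the
   witnesses are the resulting cofactors. *)
have ctm : coprimez t m.
  apply/coprimezP; exists (- s ^+ 3 + m * s ^+ 2 - m ^+ 2 * s + m ^+ 3 + 6 * s,
    12 * m * t ^+ 2 + 10 * s + 12 * m - m ^+ 3) => /=.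
  apply/eqP; rewrite -subr_eq0; apply/eqP; apply: (eq_trans (y := - 0)); last by rewrite oppr0.
  by rewrite -ems /t; ring.
pose T := r + i + 1; have eT : t = 2 * T by rewrite /t er ei /T; ring.
pose q := t ^+ 2 + t * m + m ^+ 2.
pose V := 3 * s ^+ 2 + 8 * m * s + 6 * m ^+ 2 - 1.
have eV : V ^+ 2 = 8 * t * (t + m) * q.
  apply/eqP; rewrite -subr_eq0; apply/eqP; apply: (eq_trans _ ems).
  by rewrite /V /q /t; ring.
have [W eW] : exists W, T * (t + m) * q = W ^+ 2.
  have {}eV : V ^+ 2 = 16 * (T * (t + m) * q) by rewrite eV eT; ring.
  have [X [eX|eX]] := parity V; last by rewrite eX in eV; exfalso; clear -eV; lia.
  have [Y [eY|eY]] := parity X; last by rewrite eX eY in eV; exfalso; clear -eV; lia.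
  by exists Y; rewrite eX eY in eV; clear -eV; lia.
have tm1 : t + m = 2 * (T + i) + 1 by rewrite eT ei; ring.
have cTm : coprimez T m by move: ctm; rewrite eT coprimezMl => /andP[].
have cBm : coprimez (t + m) m.
  rewrite coprimez_sym; apply: (@coprimez_lincomb m (t + m) t (-1) 1); last by ring.
  by rewrite coprimez_sym.
have cTB : coprimez T (t + m).
  by apply: (@coprimez_lincomb _ _ m (-2) 1) => //; rewrite eT; ring.
have cq : coprimez (T * (t + m)) q.
  apply: (@coprimez_lincomb _ _ (m ^+ 2) (-2) 1); last by rewrite /q eT; ring.
  by rewrite coprimezMl !coprimezXr.
have q0 : 0 < q by rewrite /q; clear -m1; nia.
have TB0 : 0 <= T * (t + m).
  by rewrite -(pmulr_lge0 _ q0) eW sqr_ge0.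
have [Z [k [eZ ek]]] := coprimez_mul_exp_ge0 TB0 (ltW q0) cq eW.
have [a ea] := coprimez_mul_exp cTB eZ.
have [h eh] : exists h, t + m = h ^+ 2 \/ t + m = - h ^+ 2.
  by apply: (@coprimez_mul_exp 2 _ T Z); rewrite 1?coprimez_sym // mulrC.
have ah0 : 0 <= a ^+ 2 * h ^+ 2 by rewrite mulr_ge0 ?sqr_ge0.
have eTB : T * (t + m) = a ^+ 2 * h ^+ 2.
  move: ah0 TB0; case: ea => ->; case: eh => ->; rewrite ?mulNr ?mulrN ?opprK // oppr_ge0 => u v;
    by apply/eqP; rewrite eqNr; apply/eqP/le_anti/andP.
have ch2 : coprimez h 2.
  have : coprimez (t + m) 2 by rewrite tm1 coprimez_2.
  by case: eh => ->; rewrite ?coprimeNz coprimez_pexpl.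
have cha : coprimez h a.
  move: cTB; rewrite coprimez_sym.
  by case: ea => ->; case: eh => ->; rewrite ?coprimezN ?coprimeNz coprimez_pexpl // coprimez_pexpr.
have T2 : T ^+ 2 = a ^+ 4 by case: ea => ->; ring.
have B2 : (t + m) ^+ 2 = h ^+ 4 by case: eh => ->; ring.
have a0 : a = 0.
  apply: (quartic_descent ch2 cha (k := k)).
  (* Expressed in [T] and [t + m], which are [a ^+ 2] and [h ^+ 2] up to a common sign unless their
     product is 0, the form [q] is the quartic of the descent. *)
  rewrite -ek; transitivity (4 * T ^+ 2 - 2 * (T * (t + m)) + (t + m) ^+ 2).
    by rewrite /q eT; ring.
  by rewrite T2 eTB B2; ring.
have t0 : t = 0.
  by rewrite eT; case: ea => ->; rewrite a0 expr0n ?oppr0 mulr0.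
have es : s = - m by rewrite -[s](addrK m) -/t t0 add0r.
rewrite t0 es in ems.
have {}ems : (m ^+ 2 - 1) ^+ 2 = 0 by apply: (eq_trans _ ems); ring.
by move/eqP: ems; rewrite sqrf_eq0 => /eqP; clear -m1; nia.
Qed.

(** * Halving quartics of the two sums with denominator [m] *)

Lemma coprimez_quotients (x y : int) : y != 0 ->
  exists g t u, [/\ g != 0, x = g * t, y = g * u & coprimez t u].
Proof.
move=> y0; set g := gcdz x y.
have [/dvdzP[t et] /dvdzP[u eu]] : (g %| x)%Z /\ (g %| y)%Z by rewrite dvdz_gcdl dvdz_gcdr.
have g0 : g != 0 by apply: contra y0 => /eqP g0; rewrite eu g0 mulr0.
exists g, t, u; split=> //; rewrite 1?mulrC //.
have [a [b e]] := Bezoutz x y; apply/coprimezP; exists (a, b) => /=.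
by apply: (mulIf g0); rewrite mulrDl -!mulrA -et -eu e mul1r.
Qed.

Lemma dvdz_3_odd (d c : int) (n : nat) :
  coprimez d 2 -> (d %| 2 ^+ n * 3 * c)%Z -> coprimez d c ->
  [\/ d = 1, d = -1, d = 3 | d = -3].
Proof.
by move=> d2 h dc; apply: dvdz_3; rewrite -(Gauss_dvdzr 3 (coprimezXr n d2)) -(Gauss_dvdzl _ dc).
Qed.

(* As a plane quartic in (s, m^2) this has a triple point at (1, 0), so the
   lines through it parametrise it: (s - 1) / m^2 = t / u. *)
Lemma halving_quartic_P1P3 (m s : int) : 1 < m ->
  halving_quartic (-1) (2 * m ^+ 4 + 2 * m ^+ 2 + 1)
    (- (3 * m ^+ 6 + 4 * m ^+ 4 + 3 * m ^+ 2 + 1)) m s != 0.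
Proof.
move=> m1; apply/eqP; rewrite /halving_quartic => e.
have m0 : m ^+ 2 != 0 by rewrite expf_neq0 //; clear -m1; lia.
have [g [t [u [g0 et eu ctu]]]] := coprimez_quotients (s - 1) m0.
(* Substituting [s = 1 + g * t] and [m ^+ 2 = g * u] turns the quartic into [g ^+ 3 * (4 * z * (z +
   u) * (z - u) - g * D)]; the shift to [z] splits the cubic part and makes [D] symmetric in [z] and
   [u]. *)
pose z := t - u.
have czu : coprimez z u.
  case/coprimezP: ctu => -[a b] /= h; apply/coprimezP; exists (a, a + b) => /=.
  by rewrite -h /z; ring.
pose D := 12 * u ^+ 2 * z ^+ 2 - (z + u) ^+ 4.
have eD : g * D = 4 * z * (z + u) * (z - u).
  apply: (mulfI (expf_neq0 3 g0)); apply/eqP; rewrite -subr_eq0; apply/eqP.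
  transitivity (- (s ^+ 4 - 6 * (2 * m ^+ 4 + 2 * m ^+ 2 + 1) * s ^+ 2 -
    8 * - (3 * m ^+ 6 + 4 * m ^+ 4 + 3 * m ^+ 2 + 1) * s - 3 * (2 * m ^+ 4 + 2 * m ^+ 2 + 1) ^+ 2 -
    4 * -1 * m ^+ 4)); last by rewrite e oppr0.
  have -> : s = g * t + 1 by rewrite -et; ring.
  have -> : m ^+ 6 = (m ^+ 2) ^+ 3 by rewrite -exprM.
  have -> : m ^+ 4 = (m ^+ 2) ^+ 2 by rewrite -exprM.
  by rewrite eu /D /z; ring.
have emD : m ^+ 2 * D = 4 * (z * u) * (z ^+ 2 - u ^+ 2).
  by rewrite eu mulrAC eD; ring.
clearbody z; clear et eu ctu e.
have cDz : coprimez D z.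
  rewrite coprimez_sym; apply: (@coprimez_lincomb _ _ (u ^+ 4)
    (- (-12 * u ^+ 2 * z + z ^+ 3 + 4 * z ^+ 2 * u + 6 * z * u ^+ 2 + 4 * u ^+ 3)) (-1)).
    by rewrite coprimezXr.
  by rewrite /D; ring.
have cDu : coprimez D u.
  rewrite coprimez_sym; apply: (@coprimez_lincomb _ _ (z ^+ 4)
    (12 * u * z ^+ 2 - u ^+ 3 - 4 * u ^+ 2 * z - 6 * u * z ^+ 2 - 4 * z ^+ 3) (-1)).
    by rewrite coprimezXr // coprimez_sym.
  by rewrite /D; ring.
(* Being prime to [z], [D] divides [4 * (z ^+ 2 - u ^+ 2)]. Eliminating [z] between the two forms
   leaves [192 * u ^+ 5], with cofactors [h] and [16 * (u + 2 * z)]. *)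
have cD : (D %| 2 ^+ 6 * 3 * u ^+ 5)%Z.
  have [f ef] : exists f, 4 * (z ^+ 2 - u ^+ 2) = D * f.
    by apply: (@dvdz_mul_ex D _ z g cDz); rewrite [RHS]mulrC eD; ring.
  pose h := (- 4 * z ^+ 2 - 16 * z * u + 20 * u ^+ 2) * (u + 2 * z) - 64 * u ^+ 3.
  apply/dvdzP; exists (f * h - 16 * (u + 2 * z)).
  transitivity (4 * (z ^+ 2 - u ^+ 2) * h - 16 * D * (u + 2 * z)).
    by rewrite /h /D; ring.
  by rewrite ef; ring.
have czuD : coprimez (z * u) (z ^+ 2 - u ^+ 2).
  rewrite coprimezMl; apply/andP; split.
    by apply: (@coprimez_lincomb _ _ (u ^+ 2) z (-1)); rewrite ?coprimezXr //; ring.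
  by apply: (@coprimez_lincomb _ _ (z ^+ 2) u 1); rewrite ?coprimezXr 1?coprimez_sym //; ring.
have [zu_odd|[r [q [ez eu]]]] : coprimez (z + u) 2 \/
    exists r q, z = 2 * r + 1 /\ u = 2 * q + 1.
  have [r [ez|ez]] := parity z; have [q [eu|eu]] := parity u.
  - by move: czu; rewrite ez eu => /coprimezP[[a b] /=]; clear; lia.
  - by left; rewrite ez eu addrA -mulrDr coprimez_2.
  - by left; rewrite ez eu addrAC -mulrDr coprimez_2.
  - by right; exists r, q.
  have [r er] : exists r, z + u = 2 * r + 1.
    have [r [er|er]] := parity (z + u); last by exists r.
    by move: zu_odd; rewrite er => /coprimezP[[a b] /=]; clear; lia.
  have [j ej] := odd_sqr r; rewrite -er in ej.
  have [y ey] : exists y, z * u = 2 * y.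
    have [r' [ez|ez]] := parity z; first by exists (r' * u); rewrite ez; ring.
    by exists (z * (r - r')); rewrite (_ : u = 2 * (r - r')); [ring | clear -er ez; lia].
  have D16 : D = 16 * (3 * y ^+ 2 - 4 * j ^+ 2 - j) - 1.
    transitivity (12 * (z * u) ^+ 2 - ((z + u) ^+ 2) ^+ 2); first by rewrite /D; ring.
    by rewrite ey ej; ring.
  (* Of the odd candidates 1, -1, 3, -3 only -1 fits modulo 16. Then [z * u] is [a ^+ 2] up to sign,
     and [D = -1] reads [(z + u) ^+ 4 - 12 * a ^+ 4 = 1]. *)
  have D1 : D = -1.
    have cD2 : coprimez D 2.
      rewrite D16; set y' := 3 * _ - _ - _.
      by have -> : 16 * y' - 1 = 2 * (8 * y' - 1) + 1; [ring | rewrite coprimez_2].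
    by case: (dvdz_3_odd cD2 cD (coprimezXr _ cDu)) => // D1; rewrite D1 in D16;
      exfalso; clear -D16; lia.
  rewrite D1 in emD.
  have [m' em] : exists m', m = 2 * m'.
    have [m' [em|em]] := parity m; first by exists m'.
    by rewrite em in emD; exfalso; clear -emD; lia.
  have em2 : z * u * (- (z ^+ 2 - u ^+ 2)) = m' ^+ 2 by rewrite em in emD; clear -emD; lia.
  have [|a ea] := coprimez_mul_exp _ em2; first by rewrite coprimezN.
  have a0 : a = 0.
    apply: (@pell_exp4 3 ((z + u) ^+ 2)); first by left.
    have a4 : a ^+ 4 = (z * u) ^+ 2 by case: ea => ->; ring.
    by rewrite a4 -[RHS]opprK -D1 /D; ring.
  have zu0 : z * u = 0 by case: ea => ->; rewrite a0 expr0n ?oppr0.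
  by rewrite zu0 mulr0 mul0r mulrN1 in emD; move/eqP: emD; rewrite oppr_eq0 (negPf m0).
pose k := r + q + 1; have ek : z + u = 2 * k by rewrite ez eu /k; ring.
have [i ei] := odd_sqr r; rewrite -ez in ei.
have [j ej] := odd_sqr q; rewrite -eu in ej.
pose E := 3 * u ^+ 2 * z ^+ 2 - 4 * k ^+ 4.
have eDE : D = 4 * E by rewrite /D ek /E; ring.
have E4 : E = 4 * (3 * (8 * i * j + i + j) * 2 - k ^+ 4) + 3.
  by rewrite /E ei ej; ring.
have E13 : E = -1 \/ E = 3.
  have cE2 : coprimez E 2.
    rewrite E4; set y' := _ - k ^+ 4.
    by have -> : 4 * y' + 3 = 2 * (2 * y' + 1) + 1; [ring | rewrite coprimez_2].
  have cEu : coprimez E u by move: cDu; rewrite eDE coprimezMl => /andP[].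
  have hE : (E %| 2 ^+ 6 * 3 * u ^+ 5)%Z.
    by apply: dvdz_trans cD; rewrite eDE dvdz_mull.
  by case: (dvdz_3_odd cE2 hE (coprimezXr _ cEu)) => E1; [|left| right|] => //;
    rewrite E1 in E4; exfalso; clear -E4; lia.
have {}emD : m ^+ 2 * E = z * u * (z ^+ 2 - u ^+ 2).
  by rewrite eDE in emD; clear -emD; lia.
(* If [E = -1], then [z], [u] and [z ^+ 2 - u ^+ 2] are squares up to sign, against [exp4_sub_sqr].
   If [E = 3], then [k = 3 * n] and [(u * z) ^+ 2 - 108 * n ^+ 4 = 1]. *)
case: E13 => E1; rewrite E1 in emD.
  have czd : coprimez z (- (u * (z ^+ 2 - u ^+ 2))).
    by rewrite coprimezN coprimezMr czu; move: czuD; rewrite coprimezMl => /andP[].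
  have cud : coprimez u (- (z * (z ^+ 2 - u ^+ 2))).
    by rewrite coprimezN coprimezMr coprimez_sym czu; move: czuD; rewrite coprimezMl => /andP[].
  have [|x ex] := coprimez_mul_exp (c := m) (k := 2) czd.
    by clear -emD; lia.
  have [|y ey] := coprimez_mul_exp (c := m) (k := 2) cud.
    by clear -emD; lia.
  have [||c ec] := @coprimez_mul_exp 2 (z ^+ 2 - u ^+ 2) (- (z * u)) m.
  - by rewrite coprimezN coprimez_sym.
  - by clear -emD; lia.
  have z2 : z ^+ 2 = x ^+ 4 by case: ex => ->; ring.
  have u2 : u ^+ 2 = y ^+ 4 by case: ey => ->; ring.
  have cx2 : coprimez x 2.
    have : coprimez z 2 by rewrite ez coprimez_2.
    by case: ex => ->; rewrite ?coprimeNz coprimez_pexpl.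
  have cy2 : coprimez y 2.
    have : coprimez u 2 by rewrite eu coprimez_2.
    by case: ey => ->; rewrite ?coprimeNz coprimez_pexpl.
  have cxy : coprimez x y.
    have : coprimez (z ^+ 2) (u ^+ 2) by apply/coprimezXl/coprimezXr.
    by rewrite z2 u2 coprimez_pexpl // coprimez_pexpr.
  have c0 : c = 0.
    rewrite z2 u2 in ec; case: ec => ec; first exact: (exp4_sub_sqr cxy cx2 cy2 ec).
    apply: (@exp4_sub_sqr y x) => //; first by rewrite coprimez_sym.
    by rewrite -[RHS]opprK -ec opprB.
  have d0 : z ^+ 2 - u ^+ 2 = 0 by case: ec => ->; rewrite c0 expr0n ?oppr0.
  by rewrite d0 mulr0 mulrN1 in emD; move/eqP: emD; rewrite oppr_eq0 (negPf m0).
have [n en] : exists n, k = 3 * n.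
  have [h3|//] := coprimez_3 k.
  have [|f ef] := @dvdz_mul_ex 3 4 (k ^+ 4) (u ^+ 2 * z ^+ 2 - 1) (coprimezXr 4 h3).
    by rewrite /E in E1; clear -E1; lia.
  by clear -ef; lia.
have n0 : n = 0.
  apply: (@pell_exp4 27 (u * z)); first by right.
  by rewrite /E en in E1; clear -E1; lia.
have zu : z = - u by apply/eqP; rewrite -addr_eq0 ek en n0.
by rewrite zu sqrrN subrr mulr0 in emD; move/eqP: emD; rewrite mulf_eq0 (negPf m0).
Qed.

(* Again a quartic in (s, m^2) with a triple point at (1, 0). *)
Lemma halving_quartic_Q1Q2 (m s : int) : 1 < m ->
  halving_quartic 1 (m ^+ 4 + 1) (- (2 * m ^+ 4 + 1)) m s != 0.
Proof.
move=> m1; apply/eqP; rewrite /halving_quartic => e.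
have m0 : m ^+ 2 != 0 by rewrite expf_neq0 //; clear -m1; lia.
have [g [t [u [g0 et eu ctu]]]] := coprimez_quotients (1 - s) m0.
pose w := t ^+ 2 + u ^+ 2.
pose D := w ^+ 2 - 8 * u ^+ 2 * w + 4 * u ^+ 4.
have eD : g * D = 4 * t * w.
  apply: (mulfI (expf_neq0 3 g0)); apply/eqP; rewrite -subr_eq0; apply/eqP.
  transitivity (s ^+ 4 - 6 * (m ^+ 4 + 1) * s ^+ 2 - 8 * - (2 * m ^+ 4 + 1) * s -
    3 * (m ^+ 4 + 1) ^+ 2 - 4 * 1 * m ^+ 4); last by [].
  have -> : s = 1 - g * t by rewrite -et; ring.
  have -> : m ^+ 4 = (m ^+ 2) ^+ 2 by rewrite -exprM.
  by rewrite eu /D /w; ring.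
have emD : m ^+ 2 * D = 4 * (t * u) * w by rewrite eu mulrAC eD; ring.
clear et eu e.
have eDtu : D = t ^+ 4 - 6 * t ^+ 2 * u ^+ 2 - 3 * u ^+ 4 by rewrite /D /w; ring.
have cDu : coprimez D u.
  rewrite coprimez_sym.
  apply: (@coprimez_lincomb _ _ (t ^+ 4) (6 * t ^+ 2 * u + 3 * u ^+ 3) 1).
    by rewrite coprimezXr // coprimez_sym.
  by rewrite eDtu; ring.
(* Here [D] and [t] may share the factor 3, so [t] is kept: [g * D * t = 4 * w * (w - u ^+ 2)].
   Subtracting [4 * D] leaves [D * h], linear in [w], and eliminating [w] leaves [192 * u ^+ 8]. *)
have cD : (D %| 2 ^+ 6 * 3 * u ^+ 8)%Z.
  pose h := g * t - 4.
  apply/dvdzP; exists (D * h ^+ 2 + 4 * u ^+ 4 * h - 196 * u ^+ 4 * g * t).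
  have e1 : g * D * t = 4 * w * (w - u ^+ 2) by rewrite eD /w; ring.
  transitivity ((28 * u ^+ 2 * w - 16 * u ^+ 4) ^+ 2
      + 4 * u ^+ 4 * (28 * u ^+ 2 * w - 16 * u ^+ 4) - 196 * u ^+ 4 * (4 * w * (w - u ^+ 2))).
    by ring.
  have -> : 28 * u ^+ 2 * w - 16 * u ^+ 4 = D * h.
    transitivity (4 * w * (w - u ^+ 2) - 4 * D); first by rewrite /D; ring.
    by rewrite -e1 /h; ring.
  by rewrite -e1; ring.
have cases P : coprimez P 2 -> (P %| D)%Z -> [\/ P = 1, P = -1, P = 3 | P = -3].
  move=> P2 /[dup] PD /dvdzP[f ef]; apply: (@dvdz_3_odd P (u ^+ 8) 6 P2).
    exact: dvdz_trans cD.
  by apply: coprimezXr; move: cDu; rewrite ef coprimezMl => /andP[].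
have [[[T et] [q eu]]|[[r et] [U eU]]|[[r et] [q eu]]] :
    [\/ (exists T, t = 2 * T + 1) /\ (exists q, u = 2 * q),
        (exists r, t = 2 * r) /\ (exists U, u = 2 * U + 1)
      | (exists r, t = 2 * r + 1) /\ (exists q, u = 2 * q + 1)].
- have [r [et|et]] := parity t; have [q [eu|eu]] := parity u.
  + by move: ctu; rewrite et eu => /coprimezP[[a b] /=]; clear; lia.
  + by apply: Or32; split; [exists r | exists q].
  + by apply: Or31; split; [exists r | exists q].
  + by apply: Or33; split; [exists r | exists q].
- have [i ei] := odd_sqr T; rewrite -et in ei.
  have t4 : t ^+ 4 = (8 * i + 1) ^+ 2 by rewrite -ei -exprM.
  have D8 : D = 8 * (8 * i ^+ 2 + 2 * i - 3 * (8 * i + 1) * q ^+ 2 - 6 * q ^+ 4) + 1.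
    by rewrite eDtu t4 ei eu; ring.
  have D1 : D = 1.
    have cD2 : coprimez D 2.
      rewrite D8; set y := _ - 6 * _.
      by have -> : 8 * y + 1 = 2 * (4 * y) + 1; [ring | rewrite coprimez_2].
    by case: (cases D cD2 (dvdzz D)) => // D1; rewrite D1 in D8; exfalso; clear -D8; lia.
  (* Completing the square, [D = (t ^+ 2 - 3 * u ^+ 2) ^+ 2 - 12 * u ^+ 4]. *)
  have u0 : u = 0.
    apply: (@pell_exp4 3 (t ^+ 2 - 3 * u ^+ 2)); first by left.
    by apply: (eq_trans _ D1); rewrite eDtu; ring.
  by rewrite D1 u0 mulr0 mulr0 mul0r mulr1 in emD; move/eqP: emD; rewrite (negPf m0).
- have [j ej] := odd_sqr U; rewrite -eU in ej.
  have u4 : u ^+ 4 = (8 * j + 1) ^+ 2 by rewrite -ej -exprM.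
  have D8 : D = 8 * (2 * r ^+ 4 - 3 * (8 * j + 1) * r ^+ 2 - 24 * j ^+ 2 - 6 * j - 1) + 5.
    by rewrite eDtu u4 ej et; ring.
  have D3 : D = -3.
    have cD2 : coprimez D 2.
      rewrite D8; set y := _ - 1.
      by have -> : 8 * y + 5 = 2 * (4 * y + 2) + 1; [ring | rewrite coprimez_2].
    by case: (cases D cD2 (dvdzz D)) => // D1; rewrite D1 in D8; exfalso; clear -D8; lia.
  have [n en] : exists n, t = 3 * n.
    have [h3|//] := coprimez_3 t.
    have [|f ef] := @dvdz_mul_ex 3 1 (t ^+ 4) (2 * t ^+ 2 * u ^+ 2 + u ^+ 4 - 1) (coprimezXr 4 h3).
      by rewrite D3 in eDtu; clear -eDtu; lia.
    by clear -ef; lia.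
  (* With [t = 3 * n], [D = -3] becomes [(u ^+ 2 + 9 * n ^+ 2) ^+ 2 - 108 * n ^+ 4 = 1]. *)
  have n0 : n = 0.
    apply: (@pell_exp4 27 (u ^+ 2 + 9 * n ^+ 2)); first by right.
    apply: (@mulfI _ (-3 : int)) => //; rewrite mulr1.
    by apply: (eq_trans _ D3); rewrite eDtu en; ring.
  rewrite D3 en n0 mulr0 mul0r mulr0 mul0r in emD.
  by move/eqP: emD; rewrite mulf_eq0 (negPf m0).
have [i ei] := odd_sqr r; rewrite -et in ei.
have [j ej] := odd_sqr q; rewrite -eu in ej.
have t4 : t ^+ 4 = (8 * i + 1) ^+ 2 by rewrite -ei -exprM.
have u4 : u ^+ 4 = (8 * j + 1) ^+ 2 by rewrite -ej -exprM.
pose v := 4 * i + 4 * j + 1; have ew : w = 2 * v by rewrite /w ei ej /v; ring.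
have [E eE E4] : exists2 E, D = 8 * E & exists y, E = 4 * y + 3.
  have [l el] := odd_sqr (2 * i - 6 * j - 1).
  exists (4 * l - 1 - 12 * (8 * j ^+ 2 + 2 * j)); last first.
    by exists (l - 3 * (8 * j ^+ 2 + 2 * j) - 1); ring.
  transitivity (4 * (2 * (2 * i - 6 * j - 1) + 1) ^+ 2 - 12 * u ^+ 4).
    by rewrite eDtu t4 u4 ei ej; ring.
  by rewrite el u4; ring.
have E13 : E = -1 \/ E = 3.
  case: E4 => y ey; have cE2 : coprimez E 2.
    rewrite ey.
    by have -> : 4 * y + 3 = 2 * (2 * y + 1) + 1; [ring | rewrite coprimez_2].
  case: (cases E cE2) => [|E1||E1|E1]; first by rewrite eE dvdz_mull.
  - by rewrite E1 in ey; exfalso; clear -ey; lia.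
  - by left.
  - by right.
  - by rewrite E1 in ey; exfalso; clear -ey; lia.
have {}emD : m ^+ 2 * E = t * u * v by rewrite eE ew in emD; clear -emD; lia.
have ev : 2 * v = t ^+ 2 + u ^+ 2 by rewrite -ew.
have v0 : 0 <= v by have := sqr_ge0 t; have := sqr_ge0 u; clear -ev; lia.
have cv2 : coprimez v 2 by rewrite /v (_ : _ + 1 = 2 * (2 * i + 2 * j) + 1) ?coprimez_2 //; ring.
have cvt : coprimez t v.
  apply: (@coprimez_lincomb _ _ (u ^+ 2) (- t) 2); first by rewrite coprimezXr.
  by rewrite ev; ring.
have cvu : coprimez u v.
  apply: (@coprimez_lincomb _ _ (t ^+ 2) (- u) 2); first by rewrite coprimezXr // coprimez_sym.
  by rewrite ev; ring.
(* If [E = 3], then [t = 3 * n] and [v = k ^+ 2], so [2 * k ^+ 2 = t ^+ 2 + u ^+ 2] would be 1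
   modulo 3. *)
case: E13 => E1; rewrite E1 in emD; last first.
  have [n en] : exists n, t = 3 * n.
    have [h3|//] := coprimez_3 t.
    have [|f ef] := @dvdz_mul_ex 3 1 (t ^+ 4) (2 * t ^+ 2 * u ^+ 2 + u ^+ 4 + 8) (coprimezXr 4 h3).
      by rewrite eE E1 in eDtu; clear -eDtu; lia.
    by clear -ef; lia.
  have c3u : coprimez 3 (u ^+ 2).
    by apply: coprimezXr; move: ctu; rewrite en coprimezMl => /andP[].
  have [||k ek] := @coprimez_mul_sqr_ge0 v (n * u) m v0.
  - rewrite coprimez_sym coprimezMl cvu andbT.
    by move: cvt; rewrite en coprimezMl => /andP[].
  by rewrite en in emD; clear -emD; lia.
  have [k' hk] := sqr_mod3 k; have [u' hu] := sqr_mod3 u.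
  rewrite ek en in ev; case: hu => hu; first by
    rewrite hu in c3u; case/coprimezP: c3u => -[a b] /=; clear; lia.
  by exfalso; case: hk ev => ->; rewrite hu; clear; lia.
(* If [E = -1], the pairwise coprime [t], [u], [v] are squares up to sign, so
   [2 * v = t ^+ 2 + u ^+ 2] has the shape of [exp4_add_double_sqr]. This gives
   [t ^+ 2 = u ^+ 2 = 1], then [v = 1] and [m ^+ 4 = 1]. *)
have [||k ek] := @coprimez_mul_sqr_ge0 v (- (t * u)) m v0.
- by rewrite coprimezN coprimez_sym coprimezMl cvt.
- by clear -emD; lia.
have ctuv : coprimez t (- (u * v)) by rewrite coprimezN coprimezMr ctu.
have cutv : coprimez u (- (t * v)) by rewrite coprimezN coprimezMr coprimez_sym ctu.
have [|x ex] := coprimez_mul_exp (c := m) (k := 2) ctuv; first by clear -emD; lia.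
have [|y ey] := coprimez_mul_exp (c := m) (k := 2) cutv; first by clear -emD; lia.
have t2 : t ^+ 2 = x ^+ 4 by case: ex => ->; ring.
have u2 : u ^+ 2 = y ^+ 4 by case: ey => ->; ring.
have cxy : coprimez x y.
  have : coprimez (t ^+ 2) (u ^+ 2) by apply/coprimezXl/coprimezXr.
  by rewrite t2 u2 coprimez_pexpl // coprimez_pexpr.
rewrite ek t2 u2 in ev.
have xy2 := exp4_add_double_sqr cxy (esym ev).
have tu2 : t ^+ 2 = u ^+ 2.
  by rewrite t2 u2 -[x ^+ 4]/(x ^+ (2 * 2)) exprM xy2 -exprM.
have t21 : t ^+ 2 = 1.
  have /coprimezP[[a b] /= hab] : coprimez (t ^+ 2) (u ^+ 2) by apply/coprimezXl/coprimezXr.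
  rewrite -tu2 -mulrDl mulrC in hab.
  by have := sqr_ge0 t; have [//|-> //|->] := dvdz_unit hab.
have m4 : m ^+ 4 = t ^+ 2 * u ^+ 2 * v ^+ 2.
  transitivity ((m ^+ 2 * -1) ^+ 2); first by ring.
  by rewrite emD; ring.
have v1 : v = 1.
  by rewrite ek; move: ev; rewrite -t2 -u2 -tu2 t21; clear; lia.
by rewrite -tu2 t21 v1 in m4; clear -m4 m1; nia.
Qed.

(** * From integer quartics to the rank *)

(* The finite part has odd order, so A / 2A has dimension r over F_2. *)
Lemma has_rank_ge (A : zmodType) (r k : nat) (v : 'I_k -> A) :
  (forall x : A, x + x = 0 -> x = 0) ->
  (forall (c : 'I_k -> bool) (x : A),
     x + x = \sum_(i | c i) v i -> forall i, ~~ c i) ->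
  has_rank A r -> (k <= r)%N.
Proof.
move=> tors indep [T [f [g fK gK]]].
(* A relation between the rows of [M] selects a subset of the [v i] whose sum has even free part. *)
pose M : 'M['F_2]_(k, r) := \matrix_(i, j) ((f (v i)).1 0 j)%:~R.
have /eqP <- : row_free M; last exact: rank_leq_col.
apply: inj_row_free => u uM.
pose c i := u 0 i != 0.
have uc i : u 0 i = (c i)%:R.
  rewrite /c; case: (u 0 i) => -[|[|//]] h; first by apply/val_inj.
  by apply/val_inj.
have [y ey] : exists y, (f (\sum_(i | c i) v i)).1 = y + y.
  have ev j : (2 %| (f (\sum_(i | c i) v i)).1 0%R j)%Z.
    rewrite (dvdz_pcharf (pchar_Fp (isT : prime 2))).
    have /rowP/(_ j) := uM; rewrite !mxE => e0; apply/eqP; apply: (eq_trans _ e0).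
    have -> : (f (\sum_(i | c i) v i)).1 = \sum_(i | c i) (f (v i)).1.
      by rewrite raddf_sum; elim/big_rec2: _ => // i p q _ <-.
    rewrite summxE rmorph_sum /= big_mkcond; apply: eq_bigr => i _.
    by rewrite mxE uc; case: (c i); rewrite ?mul1r ?mul0r.
  exists (\row_j ((f (\sum_(i | c i) v i)).1 0%R j %/ 2)%Z).
  by apply/rowP => j; rewrite !mxE -{1}(divzK (ev j)); ring.
have [t et] : exists t, (f (\sum_(i | c i) v i)).2 = t + t.
  have dinj : injective (fun t : T => t + t).
    move=> t1 t2 e; apply/eqP; rewrite -subr_eq0; apply/eqP.
    have : g (0, t1 - t2) = 0.
      apply: tors; apply: (can_inj fK); rewrite raddfD raddf0 gK.
      by rewrite -[LHS]/(0 + 0, t1 - t2 + (t1 - t2)) addr0 addrACA -opprD e subrr.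
    by move/(congr1 f); rewrite gK raddf0 => -[].
  have [h _ hK] := injF_bij dinj.
  by exists (h (f (\sum_(i | c i) v i)).2); rewrite hK.
apply/rowP => i; rewrite uc mxE.
suff /negPf -> : ~~ c i by [].
apply: (indep c (g (y, t))); apply: (can_inj fK); rewrite raddfD gK.
by rewrite [RHS]surjective_pairing ey et.
Qed.

Lemma rat_int_root (q : rat) (a b c : int) :
  q ^+ 4 + a%:~R * q ^+ 2 + b%:~R * q + c%:~R = 0 -> exists s : int, q = s%:~R.
Proof.
move=> e; have hq := divq_num_den q; set n := numq q in hq; set d := denq q in hq.
have d0 : d%:~R != 0 :> rat by rewrite intr_eq0 denq_neq0.
have e1 : n ^+ 4 + a * n ^+ 2 * d ^+ 2 + b * n * d ^+ 3 + c * d ^+ 4 = 0.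
  apply: (@intr_inj rat); rewrite -[RHS](mulr0 (d%:~R ^+ 4)) -e -hq.
  by rewrite !(rmorphD, rmorphM, rmorphXn) /=; field.
have d1 : d = 1.
  have cdn : coprimez d (n ^+ 4).
    by apply: coprimezXr; rewrite coprimez_sym coprimezE coprime_num_den.
  have := @dvdz_mul_ex d 1 (n ^+ 4) (- (a * n ^+ 2 * d + b * n * d ^+ 2 + c * d ^+ 3)) cdn.
  case; first by apply/eqP; rewrite -subr_eq0 -{}e1; apply/eqP; ring.
  move=> f ef; have [//|//|d1] := dvdz_unit (esym ef).
  by have := denq_gt0 q; rewrite -/d d1.
by exists n; rewrite -hq d1 divr1.
Qed.

Lemma add_self_eq0 (E : ellcurve rat) (a b : int) :
  ec_a E = a%:~R -> ec_b E = b%:~R ->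
  (forall u : int, u ^+ 3 + a * u + b != 0) ->
  forall W : point E, W + W = 0 -> W = 0.
Proof.
move=> ea eb ne [[[u w]|] hW] e; apply/val_inj => //=.
move/(congr1 (@point_val _ E)): e => /=; case: ifP => //; rewrite eqxx /= => /eqP e _.
have w0 : w = 0 by lra.
move: hW => /= /eqP; rewrite w0 expr0n /= ea eb => hu.
(* Multiplied by [u], the cubic becomes a monic quartic without cubic term and with constant term
   0. *)
have [|s es] := @rat_int_root u a b 0.
  by transitivity (u * (u ^+ 3 + a%:~R * u + b%:~R)); [ring | rewrite -hu mulr0].
case/eqP: (ne s); apply: (@intr_inj rat).
by rewrite !(rmorphD, rmorphM, rmorphXn) /= -es -hu.
Qed.

(** A line of slope [s / d] through (x / d^2, - y / d^3) meets the cubic in two further points, and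
    [halving_quartic] is d^4 times the discriminant of the quadratic for their abscissas. It
    vanishes at the tangent, where both points are [W]. *)
Lemma halving (E : ellcurve rat) (a x y d : int) (W : point E) :
  ec_a E = a%:~R -> d != 0 ->
  point_val (W + W) = Some (x%:~R / d%:~R ^+ 2, y%:~R / d%:~R ^+ 3) ->
  exists s : int, halving_quartic a x y d s = 0.
Proof.
case: W => -[[u w]|] hW ea d0 //=; case: ifPn => // hn.
have [] := slopeP hW hW hn; set s := slope _ _ _ _ _; clearbody s.
rewrite ea subrr !mulr0 => _ ha _ _ [ex ey].
have d0' : d%:~R != 0 :> rat by rewrite intr_eq0.
have hx : x%:~R = d%:~R ^+ 2 * (s ^+ 2 - u - u) by rewrite ex; field.
have hy : y%:~R = d%:~R ^+ 3 * (s * (u - (s ^+ 2 - u - u)) - w) by rewrite ey; field.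
pose q := d%:~R * s.
have hq : q ^+ 4 + (- 6 * x)%:~R * q ^+ 2 + (- 8 * y)%:~R * q
    + (- 3 * x ^+ 2 - 4 * a * d ^+ 4)%:~R = 0.
  by rewrite !(rmorphD, rmorphB, rmorphM, rmorphXn, rmorphN) /= hx hy ha /q; ring.
have [t et] := rat_int_root hq.
exists t; apply: (@intr_inj rat); rewrite -[RHS]hq et /halving_quartic.
by rewrite -!(rmorphXn, rmorphM, rmorphD) /=; congr (_%:~R); ring.
Qed.

(** A root has [- u > 1], and the coprime factors [- u] and [u ^+ 2 - 1] of the square [m ^+ 6]
    would both be squares; but [u ^+ 2 - 1] lies strictly between consecutive squares. *)
Lemma cubic_Em_neq0 (m u : int) : m != 0 -> u ^+ 3 + -1 * u + m ^+ 6 != 0.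
Proof.
move=> m0; apply/eqP => e.
have m6 : 0 < (m ^+ 3) ^+ 2 by rewrite exprn_even_gt0 // expf_neq0.
have e1 : - u * (u ^+ 2 - 1) = (m ^+ 3) ^+ 2 by clear -e; lia.
have cu : coprimez (- u) (u ^+ 2 - 1) by apply/coprimezP; exists (- u, -1) => /=; ring.
have u1 : 1 < - u.
  rewrite -e1 in m6; clear -m6; have [//|u1] := ltP 1 (- u).
  have [e|[e|u0]] : u = -1 \/ u = 0 \/ 1 <= u by lia.
  - by rewrite e in m6.
  - by rewrite e in m6.
  - by nia.
have u2 : 0 <= u ^+ 2 - 1 by clear -u1; nia.
have u0 : 0 <= - u by clear -u1; lia.
have [_ [c [_ ec]]] := coprimez_mul_exp_ge0 u0 u2 cu e1.
have ec' : `|c| ^+ 2 = u ^+ 2 - 1 by rewrite real_normK ?num_real.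
have := normr_ge0 c; move: `|c| ec' => C; clear -u1 => eC C0.
have Cu : C < - u by nia.
by nia.
Qed.

Lemma cubic_Em'_neq0 (m u : int) : m != 0 -> u ^+ 3 + 1 * u + - m ^+ 6 != 0.
Proof.
move=> m0; apply/eqP => e.
have m6 : 0 < (m ^+ 3) ^+ 2 by rewrite exprn_even_gt0 // expf_neq0.
have e1 : u * (u ^+ 2 + 1) = (m ^+ 3) ^+ 2 by clear -e; lia.
have cu : coprimez u (u ^+ 2 + 1) by apply/coprimezP; exists (- u, 1) => /=; ring.
have u1 : 0 < u by rewrite -e1 in m6; clear -m6; nia.
have u2 : 0 <= u ^+ 2 + 1 by clear -u1; nia.
have [_ [c [_ ec]]] := coprimez_mul_exp_ge0 (ltW u1) u2 cu e1.
have ec' : `|c| ^+ 2 = u ^+ 2 + 1 by rewrite real_normK ?num_real.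
have := normr_ge0 c; move: `|c| ec' => C; clear -u1 => eC C0.
have Cu : u < C by nia.
by nia.
Qed.

(** Supplying the slope as a witness turns each explicit sum into identities for [ring] or
    [field]. *)
Lemma point_val_chord (K : fieldType) (E : ellcurve K) (P Q : point E) (x1 y1 x2 y2 s : K) :
  point_val P = Some (x1, y1) -> point_val Q = Some (x2, y2) ->
  x1 != x2 -> y2 - y1 = s * (x2 - x1) ->
  point_val (P + Q) = Some (s ^+ 2 - x1 - x2, s * (x1 - (s ^+ 2 - x1 - x2)) - y1).
Proof.
move=> eP eQ x12 e; rewrite [LHS]/(add_val E (point_val P) (point_val Q)) eP eQ.
rewrite /add_val (negPf x12) /= /slope (negPf x12).
by rewrite e mulfK // subr_eq0 eq_sym.
Qed.

Lemma not_double (E : ellcurve rat) (a x y d : int) (P W : point E) :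
  ec_a E = a%:~R -> d != 0 ->
  point_val P = Some (x%:~R / d%:~R ^+ 2, y%:~R / d%:~R ^+ 3) ->
  (forall s, halving_quartic a x y d s != 0) -> W + W <> P.
Proof.
move=> ea d0 eP h eW; rewrite -eW in eP; have [s es] := halving ea d0 eP.
by move: (h s); rewrite es eqxx.
Qed.

Lemma not_double_int (E : ellcurve rat) (a x y : int) (P W : point E) :
  ec_a E = a%:~R -> point_val P = Some (x%:~R, y%:~R) ->
  (forall s, halving_quartic a x y 1 s != 0) -> W + W <> P.
Proof.
by move=> ea eP; apply: not_double ea _ _ => //; rewrite eP !expr1n !divr1.
Qed.

Theorem theorem1p5 (m : int) (hm : 1 < m) :
  (forall r : nat, has_rank (point (Em m)) r -> (3 <= r)%N) /\
  (forall r : nat, has_rank (point (Em' m)) r -> (2 <= r)%N).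
Proof.
have m0 : m != 0 by clear -hm; lia.
set M : rat := m%:~R; have M0 : M != 0 by rewrite intr_eq0.
have M1 : M ^+ 2 + 1 != 0 by rewrite gt_eqF // ltr_wpDl ?sqr_ge0.
have M21 : M ^+ 2 - 1 != 0.
  by rewrite subr_eq0 -(rmorphXn _ 2 m) (eqr_int _ _ 1); clear -hm; nia.
split=> r.
  have on1 : on_curve (Em m) (Some (0, M ^+ 3)) by rewrite /= rmorphXn /=; apply/eqP; ring.
  have on2 : on_curve (Em m) (Some (1, M ^+ 3)) by rewrite /= rmorphXn /=; apply/eqP; ring.
  have on3 : on_curve (Em m) (Some (- M ^+ 2, - M)) by rewrite /= rmorphXn /=; apply/eqP; ring.
  pose P1 := Point on1; pose P2 := Point on2; pose P3 := Point on3.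
  have v12 : point_val (P1 + P2) = Some (-1, - M ^+ 3).
    rewrite (@point_val_chord _ _ P1 P2 _ _ _ _ 0 erefl erefl).
    - by congr (Some (_, _)); ring.
    - by rewrite eq_sym oner_eq0.
    - by ring.
  have v23 : point_val (P2 + P3) = Some (2 * M ^+ 2 - 1, 2 * M - 3 * M ^+ 3).
    rewrite (@point_val_chord _ _ P2 P3 _ _ _ _ M erefl erefl).
    - by congr (Some (_, _)); ring.
    - by rewrite -subr_eq0 opprK addrC.
    - by ring.
  have v13 : point_val (P1 + P3) = Some ((2 * M ^+ 4 + 2 * M ^+ 2 + 1) / M ^+ 2,
     - (3 * M ^+ 6 + 4 * M ^+ 4 + 3 * M ^+ 2 + 1) / M ^+ 3).
    rewrite (@point_val_chord _ _ P1 P3 _ _ _ _ ((M ^+ 2 + 1) / M) erefl erefl).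
    - by congr (Some (_, _)); field.
    - by rewrite eq_sym oppr_eq0 expf_neq0.
    - by field.
  have v123 : point_val (P1 + P2 + P3) = Some (2 * M ^+ 2 + 1, 3 * M ^+ 3 + 2 * M).
    rewrite (@point_val_chord _ _ (P1 + P2) P3 _ _ _ _ (- M) v12 erefl).
    - by congr (Some (_, _)); ring.
    - by rewrite -subr_eq0 opprK addrC.
    - by ring.
  apply: (@has_rank_ge _ _ _ (fun i : 'I_3 => nth 0 [:: P1; P2; P3] i)).
    apply: (add_self_eq0 (a := -1) (b := m ^+ 6)); rewrite ?rmorphN //.
    by move=> u; apply: cubic_Em_neq0.
  have eA : ec_a (Em m) = (-1)%:~R by rewrite rmorphN.
  have casts := (rmorphD, rmorphB, rmorphM, rmorphXn, rmorphN).
  have n100 W : W + W <> P1.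
    apply: (@not_double_int _ (-1) 0 (m ^+ 3)) => //; first by rewrite rmorphXn.
    exact: halving_quartic_P1.
  have n010 W : W + W <> P2.
    apply: (@not_double_int _ (-1) 1 (m ^+ 3)) => //; first by rewrite rmorphXn.
    exact: halving_quartic_P2.
  have n001 W : W + W <> P3.
    apply: (@not_double_int _ (-1) (- m ^+ 2) (- m)) => //; first by rewrite !casts.
    by move=> s; apply: halving_quartic_P3.
  have n110 W : W + W <> P1 + P2.
    apply: (@not_double_int _ (-1) (-1) (- m ^+ 3)) => //; first by rewrite v12 !casts.
    by move=> s; apply: halving_quartic_P1P2; rewrite exprn_egt1.
  have n011 W : W + W <> P2 + P3.
    apply: (@not_double_int _ (-1) (2 * m ^+ 2 - 1) (2 * m - 3 * m ^+ 3)) => //.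
      by rewrite v23 !casts.
    exact: halving_quartic_P2P3.
  have n101 W : W + W <> P1 + P3.
    apply: (@not_double _ (-1) (2 * m ^+ 4 + 2 * m ^+ 2 + 1)
      (- (3 * m ^+ 6 + 4 * m ^+ 4 + 3 * m ^+ 2 + 1)) m) => //.
      by rewrite v13 !casts.
    by move=> s; apply: halving_quartic_P1P3.
  have n111 W : W + W <> P1 + P2 + P3.
    apply: (@not_double_int _ (-1) (2 * m ^+ 2 + 1) (3 * m ^+ 3 + 2 * m)) => //.
      by rewrite v123 !casts.
    by move=> s; apply: halving_quartic_P1P2P3.
  move=> c W; rewrite big_mkcond !big_ord_recl big_ord0 /= addr0 => e.
  have [c0 c1 c2] : [/\ ~~ c ord0, ~~ c (lift ord0 ord0) & ~~ c (lift ord0 (lift ord0 ord0))].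
    move: e; case: (c ord0); case: (c (lift ord0 ord0));
      case: (c (lift ord0 (lift ord0 ord0))); rewrite ?addr0 ?add0r ?addrA //;
      by [move/n111|move/n110|move/n101|move/n100|move/n011|move/n010|move/n001].
  by case=> -[|[|[|//]]] h; [move: c0|move: c1|move: c2]; congr (~~ c _); apply/val_inj.
have on1 : on_curve (Em' m) (Some (M ^+ 6, M ^+ 9)) by rewrite /= rmorphXn /=; apply/eqP; ring.
have on2 : on_curve (Em' m) (Some (M ^+ 2, M)) by rewrite /= rmorphXn /=; apply/eqP; ring.
pose Q1 := Point on1; pose Q2 := Point on2.
have v12 : point_val (Q1 + Q2) = Some ((M ^+ 4 + 1) / M ^+ 2, - (2 * M ^+ 4 + 1) / M ^+ 3).
  rewrite (@point_val_chord _ _ Q1 Q2 _ _ _ _ ((M ^+ 4 + 1) / M) erefl erefl).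
  - by congr (Some (_, _)); field.
  - rewrite -subr_eq0 (_ : _ - _ = M ^+ 2 * (M ^+ 2 - 1) * (M ^+ 2 + 1)); last by ring.
    by rewrite !mulf_neq0 // expf_neq0.
  - by field.
apply: (@has_rank_ge _ _ _ (fun i : 'I_2 => nth 0 [:: Q1; Q2] i)).
  apply: (add_self_eq0 (a := 1) (b := - m ^+ 6)); rewrite ?rmorphN //.
  by move=> u; apply: cubic_Em'_neq0.
have casts := (rmorphD, rmorphB, rmorphM, rmorphXn, rmorphN).
have m31 : 1 < m ^+ 3 by rewrite exprn_egt1.
have n10 W : W + W <> Q1.
  (* [Q1] has the cuspidal form [(n ^+ 2, n ^+ 3)] with [n = m ^+ 3]. *)
  apply: (@not_double_int _ 1 ((m ^+ 3) ^+ 2) ((m ^+ 3) ^+ 3)) => //.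
    by rewrite -!exprM !casts.
  by move=> s; apply: halving_quartic_Q1.
have n01 W : W + W <> Q2.
  apply: (@not_double_int _ 1 (m ^+ 2) m) => //; first by rewrite !casts.
  exact: halving_quartic_Q2.
have n11 W : W + W <> Q1 + Q2.
  apply: (@not_double _ 1 (m ^+ 4 + 1) (- (2 * m ^+ 4 + 1)) m) => //.
    by rewrite v12 !casts.
  by move=> s; apply: halving_quartic_Q1Q2.
move=> c W; rewrite big_mkcond !big_ord_recl big_ord0 /= addr0 => e.
have [c0 c1] : ~~ c ord0 /\ ~~ c (lift ord0 ord0).
  move: e; case: (c ord0); case: (c (lift ord0 ord0)); rewrite ?addr0 ?add0r //;
    by [move/n11|move/n10|move/n01].
by case=> -[|[|//]] h; [move: c0|move: c1]; congr (~~ c _); apply/val_inj.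
Qed.
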